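(* Let $\{m_n\}_{n\ge 0}$ and $\{m'_n\}_{n\ge 0}$ be the moments and infinitesimal moments of an infinitesimal distribution (so $m_0=1$, $m'_0=0$), with free cumulants $\{\kappa_n\}_{n\ge1}$ and infinitesimal free cumulants $\{\kappa'_n\}_{n\ge1}$. Let $G(z)=\sum_{n\ge0} m_n z^{-(n+1)}$ be the Cauchy transform, $g(z)=\sum_{n\ge1} m'_n z^{-(n+1)}$ the infinitesimal Cauchy transform, $R(z)=\sum_{n\ge1}\kappa_n z^{n-1}$ the $R$-transform and $r(z)=\sum_{n\ge1}\kappa'_n z^{n-1}$ the infinitesimal $r$-transform. Then $$g(z) = -\,r(G(z))\,G'(z)$$ and $$r(z) = -\,g(K(z))\,K'(z),$$ where $K(z)=\frac1z+R(z)=G^{\langle -1\rangle}(z)$ (the compositional inverse of $G$), $G'=\frac{dG}{dz}$ and $K'=\frac{dK}{dz}$.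
   Context: An (algebraic) infinitesimal distribution is a pair $(\mu,\mu')$ of linear functionals on $\mathbb{C}[x]$ with $\mu(1)=1$ and $\mu'(1)=0$; its moments and infinitesimal moments are $m_n=\mu(x^n)$ and $m'_n=\mu'(x^n)$. Let $NC(n)$ be the set of non-crossing partitions of $\{1,\dots,n\}$. The free cumulants $\kappa_n$ and infinitesimal free cumulants $\kappa'_n$ are the unique sequences determined recursively by requiring, for all $n\ge1$, $$m_n=\sum_{\pi\in NC(n)}\ \prod_{V\in\pi}\kappa_{|V|},\qquad m'_n=\sum_{\pi\in NC(n)}\ \sum_{V\in\pi}\kappa'_{|V|}\prod_{W\in\pi,\,W\neq V}\kappa_{|W|}.$$ The transforms are regarded as formal series: $G,g$ are formal power series in $z^{-1}$, $R,r$ are formal power series in $z$, and $K$ is a formal Laurent series in $z$. The identities are identities of formal series. *)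

(* Defs.v *)
From HB Require Import structures.
From mathcomp Require Import all_boot all_order all_algebra.
From mathcomp Require Import boolp classical_sets functions cardinality fsbigop.
From mathcomp Require Import reals.
From mathcomp Require Import zify.
From mathcomp.real_closed Require Import complex.

Set Implicit Arguments.
Unset Strict Implicit.
Unset Printing Implicit Defensive.

Import Order.TTheory GRing.Theory Num.Theory.

Local Open Scope ring_scope.

Section LaurentSeries.
Variable F : fieldType.

Definition vanishes_below (N : int) (c : int -> F) :=
  forall k : int, k < N -> c k = 0.

(* The field F((t)); [lcoef f k] is the coefficient of t^k. *)
Record laurent := Laurent {
  lcoef :> int -> F;
  lcoef_bounded : exists N, vanishes_below N lcoef }.

Implicit Types f g h : laurent.

Lemma laurentP f g : (forall k, f k = g k) <-> f = g.
Proof.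
split=> [|-> //]; case: f g => [f bf] [g bg] /= /funext fg.
by case: g / fg bg => bg; congr Laurent; apply: Prop_irrelevance.
Qed.

HB.instance Definition _ := gen_eqMixin laurent.
HB.instance Definition _ := gen_choiceMixin laurent.

Lemma vanishes_belowW (M N : int) (c : int -> F) :
  M <= N -> vanishes_below N c -> vanishes_below M c.
Proof. by move=> MN cN k kM; apply: cN; apply: lt_le_trans kM MN. Qed.

Lemma laurent_bounded2 f g :
  exists N, vanishes_below N f /\ vanishes_below N g.
Proof.
case: (lcoef_bounded f) (lcoef_bounded g) => [M fM] [N gN].
exists (Order.min M N).
by split; [apply: vanishes_belowW fM | apply: vanishes_belowW gN];
  rewrite ge_min lexx ?orbT.
Qed.

Fact lzero_subproof : exists N, vanishes_below N (fun=> 0).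
Proof. by exists 0. Qed.
Definition lzero := Laurent lzero_subproof.

Fact ladd_subproof f g : exists N, vanishes_below N (fun k => f k + g k).
Proof.
have [N [fN gN]] := laurent_bounded2 f g.
by exists N => k kN; rewrite fN ?gN ?addr0.
Qed.
Definition ladd f g := Laurent (ladd_subproof f g).

Fact lopp_subproof f : exists N, vanishes_below N (fun k => - f k).
Proof.
by have [N fN] := lcoef_bounded f; exists N => k kN; rewrite fN ?oppr0.
Qed.
Definition lopp f := Laurent (lopp_subproof f).

Fact laddA : associative ladd.
Proof. by move=> f g h; apply/laurentP => k /=; rewrite addrA. Qed.
Fact laddC : commutative ladd.
Proof. by move=> f g; apply/laurentP => k /=; rewrite addrC. Qed.
Fact ladd0 : left_id lzero ladd.
Proof. by move=> f; apply/laurentP => k /=; rewrite add0r. Qed.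
Fact laddN : left_inverse lzero lopp ladd.
Proof. by move=> f; apply/laurentP => k /=; rewrite addNr. Qed.

HB.instance Definition _ :=
  GRing.isZmodule.Build laurent laddA laddC ladd0 laddN.

(* A finitely supported sum, since c and d vanish far enough to the left. *)
Definition lconv (c d : int -> F) (k : int) : F :=
  \sum_(i \in [set: int]%classic) c i * d (k - i).

Definition ltrunc (N : int) (n : nat) (c : int -> F) : {poly F} :=
  \poly_(i < n.+1) c (i%:Z + N).

Lemma coef_ltrunc N n c i : (i <= n)%N -> (ltrunc N n c)`_i = c (i%:Z + N).
Proof. by move=> le_in; rewrite coef_poly ltnS le_in. Qed.

Lemma lconv_below M N c d : vanishes_below M c -> vanishes_below N d ->
  vanishes_below (M + N) (lconv c d).
Proof.
move=> cM dN k kMN; apply: fsbig1 => i _.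
have [/cM ->|iM] := ltP i M; first by rewrite mul0r.
by rewrite dN ?mulr0 //; lia.
Qed.

Lemma lconvE M N c d n : vanishes_below M c -> vanishes_below N d ->
  lconv c d (n%:Z + (M + N)) = (ltrunc M n c * ltrunc N n d)`_n.
Proof.
move=> cM dN; rewrite coefM /lconv.
rewrite (fsbigE [seq i%:Z + M | i <- iota 0 n.+1]).
- rewrite (eq_bigl xpredT); last by move=> i; rewrite in_setT.
  rewrite big_map -[iota _ _]/(index_iota 0 n.+1) big_mkord.
  apply: eq_bigr => i _; rewrite !coef_ltrunc ?leq_subr // -1?ltnS //.
  by congr (_ * d _); have := ltn_ord i; lia.
- by rewrite map_inj_uniq ?iota_uniq // => x y; lia.
- by [].
- move=> i _ /negP ni.
  have [/cM ->|iM] := ltP i M; first by rewrite mul0r.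
  have [/dN ->|iN] := ltP (n%:Z + (M + N) - i) N; first by rewrite mulr0.
  case: ni; apply/mapP; exists `|i - M|%N; last lia.
  by rewrite mem_iota; lia.
Qed.

Lemma lconv_ind (P : F -> F -> Prop) N (c d : int -> F) :
  P 0 0 -> vanishes_below N c -> vanishes_below N d ->
  (forall n : nat, P (c (n%:Z + N)) (d (n%:Z + N))) -> forall k, P (c k) (d k).
Proof.
move=> P0 cN dN Pn k; have [kN|kN] := ltP k N; first by rewrite cN ?dN.
by have -> : k = `|k - N|%N%:Z + N by lia.
Qed.

Lemma coefM_ext (p p' q q' : {poly F}) n :
  (forall i, (i <= n)%N -> p`_i = p'`_i) ->
  (forall i, (i <= n)%N -> q`_i = q'`_i) -> (p * q)`_n = (p' * q')`_n.
Proof.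
move=> pp qq; rewrite !coefM; apply: eq_bigr => i _.
by rewrite pp ?qq ?leq_subr // -ltnS.
Qed.

Lemma ltrunc_lconv M N c d n i : vanishes_below M c -> vanishes_below N d ->
  (i <= n)%N ->
  (ltrunc (M + N) n (lconv c d))`_i = (ltrunc M n c * ltrunc N n d)`_i.
Proof.
move=> cM dN le_in; rewrite coef_ltrunc // lconvE //.
by apply: coefM_ext => j le_ji; rewrite !coef_ltrunc // (leq_trans le_ji).
Qed.

Fact lmul_subproof f g : exists N, vanishes_below N (lconv f g).
Proof.
case: (lcoef_bounded f) (lcoef_bounded g) => [M fM] [N gN].
by exists (M + N); apply: lconv_below.
Qed.
Definition lmul f g := Laurent (lmul_subproof f g).

Fact lmonom_subproof (n : int) :
  exists N, vanishes_below N (fun k => (k == n)%:R : F).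
Proof. by exists n => k kn; rewrite lt_eqF. Qed.
(* The monomial t^n. *)
Definition lmonom n := Laurent (lmonom_subproof n).

Fact lmulC : commutative lmul.
Proof.
move=> f g; apply/laurentP.
case: (lcoef_bounded f) (lcoef_bounded g) => [M fM] [N gN].
apply: (@lconv_ind eq (M + N)) => //; first exact: lconv_below.
  by rewrite addrC; apply: lconv_below.
by move=> n /=; rewrite lconvE // [M + N]addrC lconvE // mulrC.
Qed.

Fact lmulA : associative lmul.
Proof.
move=> f g h; apply/laurentP.
case: (lcoef_bounded f) (lcoef_bounded g) (lcoef_bounded h)
  => [M fM] [N gN] [P hP].
have fgB := lconv_below fM gN; have ghB := lconv_below gN hP.
apply: (@lconv_ind eq (M + (N + P))) => //; first exact: lconv_below.
  by rewrite addrA; apply: lconv_below.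
move=> n /=; rewrite lconvE // [M + (N + P)]addrA lconvE //.
rewrite (@coefM_ext _ (ltrunc M n f) _ (ltrunc N n g * ltrunc P n h)) //.
  rewrite mulrA; apply: coefM_ext => // i le_in.
  by rewrite ltrunc_lconv.
by move=> i le_in; rewrite ltrunc_lconv.
Qed.

Fact lmul1 : left_id (lmonom 0) lmul.
Proof.
move=> f; apply/laurentP; have [N fN] := lcoef_bounded f.
have oneB : vanishes_below 0 (lmonom 0) by move=> k k0 /=; rewrite lt_eqF.
apply: (@lconv_ind eq (0 + N)); rewrite ?add0r //.
  by rewrite -{1}[N]add0r; apply: lconv_below.
move=> n /=; rewrite -{1}[N]add0r lconvE //.
rewrite (@coefM_ext _ 1 _ (ltrunc N n f)) ?mul1r ?coef_ltrunc //.
by move=> i le_in; rewrite coef_ltrunc // coef1 /= addr0.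
Qed.

Fact lmulDl : left_distributive lmul ladd.
Proof.
move=> f g h; apply/laurentP.
have [M [fM gM]] := laurent_bounded2 f g; have [N hN] := lcoef_bounded h.
have fgM : vanishes_below M (ladd f g).
  by move=> k kM /=; rewrite fM ?gM ?addr0.
have fB := lconv_below fM hN; have gB := lconv_below gM hN.
apply: (@lconv_ind eq (M + N)) => //; first exact: lconv_below.
  by move=> k kMN /=; rewrite fB ?gB ?addr0.
move=> n /=; rewrite !lconvE // -coefD -mulrDl.
by apply: coefM_ext => // i le_in; rewrite coefD !coef_ltrunc.
Qed.

Fact lone_neq0 : lmonom 0 != 0.
Proof.
apply/eqP => /laurentP/(_ 0) /= /eqP.
by rewrite oner_eq0.
Qed.

HB.instance Definition _ := GRing.Zmodule_isComNzRing.Build laurent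
  lmulA lmulC lmul1 lmulDl lone_neq0.

(* The multiplicative inverse, which exists by [linv_exists]; 0 if f = 0. *)
Definition linv f : laurent := xget 0 [set g | g * f = 1]%classic.

Lemma power_series_inv (u : nat -> F) : u 0%N != 0 ->
  exists b : nat -> F, forall n,
    \sum_(i < n.+1) u i * b (n - i)%N = (n == 0%N)%:R.
Proof.
move=> u0.
pose step n (s : seq F) : F :=
  (u 0%N)^-1 * ((n == 0%N)%:R - \sum_(i < n) u i.+1 * s`_(n - i.+1)).
pose bs := fix bs n : seq F :=
  if n is n'.+1 then rcons (bs n') (step n' (bs n')) else [::].
have size_bs n : size (bs n) = n by elim: n => //= n IHn; rewrite size_rcons IHn.
pose b n := (bs n.+1)`_n.
have bsE n i : (i < n)%N -> (bs n)`_i = b i.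
  elim: n => // n IHn; rewrite ltnS leq_eqVlt => /predU1P[-> //|lt_in].
  by rewrite /= nth_rcons size_bs lt_in IHn.
exists b => n; rewrite big_ord_recl subn0.
have -> : b n = step n (bs n) by rewrite /b /= nth_rcons size_bs ltnn eqxx.
rewrite /step mulVKf //.
rewrite (_ : \sum_(i < n) u (lift ord0 i) * _
  = \sum_(i < n) u i.+1 * (bs n)`_(n - i.+1)) ?subrK //.
by apply: eq_bigr => i _; rewrite bsE //; have := ltn_ord i; lia.
Qed.

Lemma linv_exists f : f != 0 -> exists g, g * f = 1.
Proof.
move=> nz_f; have [N fN] := lcoef_bounded f.
have ex_n : exists n : nat, f (n%:Z + N) != 0.
  apply/not_existsP => f0; case/eqP: nz_f; apply/laurentP => k.
  have [/fN//|kN] := ltP k N.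
  have -> : k = `|k - N|%N%:Z + N by lia.
  by apply/eqP/negPn/negP/f0.
case: (ex_minnP ex_n) => m fm min_m; pose v : int := m%:Z + N.
have fv : vanishes_below v f.
  move=> k kv; have [/fN//|kN] := ltP k N.
  apply/eqP/negPn/negP => fk; have := min_m `|k - N|%N.
  have -> : `|k - N|%N%:Z + N = k by lia.
  by move=> /(_ fk); lia.
have [] := @power_series_inv (fun n => f (n%:Z + v)); first by rewrite add0r.
move=> b bE; pose c (k : int) := if k + v is Posz n then b n else 0.
have cv : vanishes_below (- v) c.
  by move=> k kv; rewrite /c; case E: (k + v) => [n|//]; lia.
have cB : exists N, vanishes_below N c by exists (- v).
exists (Laurent cB); rewrite mulrC; apply/laurentP.
have oneB : vanishes_below 0 (lmonom 0) by move=> k k0 /=; rewrite lt_eqF.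
apply: (@lconv_ind eq 0) => //.
  by rewrite -[0](subrr v); apply: lconv_below.
move=> n; rewrite -{1}[0](subrr v) [LHS]lconvE // coefM.
rewrite -[RHS]/((n%:Z + 0 == 0)%:R) addr0 -[RHS]bE.
apply: eq_bigr => i _; rewrite !coef_ltrunc ?leq_subr // -1?ltnS //.
by rewrite /= /c subrK.
Qed.

Fact lmulV f : f != 0 -> linv f * f = 1.
Proof.
move=> /linv_exists [g gf]; rewrite /linv.
by case: xgetP => // /(_ g).
Qed.

Fact linv0 : linv 0 = 0.
Proof.
rewrite /linv; case: xgetP => // g _ /= /eqP.
by rewrite mulr0 eq_sym oner_eq0.
Qed.

HB.instance Definition _ := GRing.ComNzRing_isField.Build laurent lmulV linv0.

Fact lseries_subproof (a : nat -> F) :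
  exists N, vanishes_below N (fun k => if k is Posz n then a n else 0).
Proof. by exists 0 => - [n|n] //. Qed.
(* The power series \sum_(n >= 0) a_n t^n. *)
Definition lseries a := Laurent (lseries_subproof a).

Fact lderiv_subproof f :
  exists N, vanishes_below N (fun k => (k + 1)%:~R * f (k + 1)).
Proof.
have [N fN] := lcoef_bounded f; exists (N - 1) => k kN.
by rewrite fN ?mulr0 //; lia.
Qed.
(* The formal derivative d/dt, where t is the variable of the series. *)
Definition lderiv f := Laurent (lderiv_subproof f).

Fact lderivV_subproof f :
  exists N, vanishes_below N (fun k => - (k - 1)%:~R * f (k - 1)).
Proof.
have [N fN] := lcoef_bounded f; exists (N + 1) => k kN.
by rewrite fN ?mulr0 //; lia.
Qed.
(* The formal derivative d/dz of a series in the variable t = z^-1: it maps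
   z^(-n) to - n z^(-n-1), i.e. t^n to - n t^(n+1). *)
Definition lderivV f := Laurent (lderivV_subproof f).

(* The substitution t := h, i.e. \sum_k f_k h^k. It is meaningful when h has
   positive order: h^k then has order at least k for k >= 0, so that each
   coefficient is a finitely supported sum and the resulting coefficients are
   again bounded below. Otherwise the value is irrelevant. *)
Definition lcomp_coef f h (j : int) : F :=
  \sum_(k \in [set: int]%classic) f k * (h ^ k) j.

Definition lcomp f h : laurent :=
  if pselect (exists N, vanishes_below N (lcomp_coef f h)) is left b
  then Laurent b else 0.

(* For f a series in z^-1, the substitution z := h, i.e. \sum_k f_k h^(-k);
   it is meaningful when h^-1 has positive order. *)
Definition lcompV f h : laurent := lcomp f h^-1.

(* K is the compositional inverse of G, for G a series in z^-1 and K a series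
   in z: G(K(z)) = z in F((z)) and K(G(z)) = z in F((z^-1)), where z is the
   monomial of exponent -1. *)
Definition comp_inverse (G K : laurent) :=
  lcompV G K = lmonom 1 /\ lcomp K G = lmonom (-1).

End LaurentSeries.

Section Infinitesimal.
Variable F : fieldType.

Record inf_distribution := InfDistribution {
  law : {scalar {poly F}};
  inf_law : {scalar {poly F}};
  law1 : law 1 = 1;
  inf_law1 : inf_law 1 = 0 }.

Definition moment (d : inf_distribution) (n : nat) : F := law d 'X^n.
Definition inf_moment (d : inf_distribution) (n : nat) : F := inf_law d 'X^n.

Definition crossing n (V W : {set 'I_n}) : bool :=
  [exists a in V, exists b in W, exists c in V, exists d in W,
    [&& a < b, b < c & c < d]%N].

Definition NC n : {set {set {set 'I_n}}} :=
  [set P | finset.partition P [set: 'I_n] &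
    [forall V in P, forall W in P, (V != W) ==> ~~ crossing V W]]%SET.

(* kappa 0 is irrelevant: it occurs in no equation, blocks being nonempty. *)
Definition free_cumulants (d : inf_distribution) (kappa : nat -> F) :=
  forall n, (1 <= n)%N ->
    moment d n = \sum_(P in NC n) \prod_(V in P) kappa #|V|.

Definition inf_free_cumulants (d : inf_distribution) (kappa kappa' : nat -> F) :=
  forall n, (1 <= n)%N ->
    inf_moment d n = \sum_(P in NC n) \sum_(V in P)
      kappa' #|V| * \prod_(W in P | W != V) kappa #|W|.

(* Series in the variable z^-1. *)
Definition cauchy_transform (d : inf_distribution) : laurent F :=
  lseries (fun k => if k is n.+1 then moment d n else 0).
Definition inf_cauchy_transform (d : inf_distribution) : laurent F :=
  lseries (fun k => if k is n.+1 then
                      if (1 <= n)%N then inf_moment d n else 0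
                    else 0).

(* Series in the variable z. *)
Definition R_transform (kappa : nat -> F) : laurent F :=
  lseries (fun n => kappa n.+1).
Definition inf_r_transform (kappa' : nat -> F) : laurent F :=
  lseries (fun n => kappa' n.+1).
Definition K_transform (kappa : nat -> F) : laurent F :=
  lmonom F (-1) + R_transform kappa.

End Infinitesimal.

(* Main.v *)
(* Write [t = z^-1], and let [U_s] collect the sums over non-crossing partitions
   in which the block of the first point counts for [s] more points than it has.
   Splitting a partition at the second point of that block gives
   [U_s = kappa_(s+1) G + G U_(s+1)] and [G = t (1 + U_0)], whence
   [U_0 = G R(G)] and [K(G) = z].  Evaluating the same sums on
   [kappa + X kappa'] and keeping the coefficient of [X] yields the first order
   variation of these identities, [g = t (G r(G) + g (z R(z))'(G))], which is
   [r(G) = - g K'(G)].  Both formulas follow, the first by differentiating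
   [K(G) = z], the second because [f |-> f(G)] is injective. *)

Require Import Defs.
From HB Require Import structures.
From mathcomp Require Import all_boot all_order all_algebra.
From mathcomp Require Import zify ring.

Import Order.TTheory GRing.Theory Num.Theory.
Local Open Scope ring_scope.

Set Implicit Arguments.
Unset Strict Implicit.
Unset Printing Implicit Defensive.

(** * Non-crossing partitions of an interval *)

(** Decomposing along the whole block of the first point would give one factor per gap, for blocks
    of every size. Splitting at the second point leaves only two intervals, at the price of a block
    that has lost a point. The shift [s] keeps count of such points, so the recursion never closes
    at a fixed [s]: it is an infinite affine system, solved uniquely by power series because each
    step multiplies by [G], of positive order. It then suffices to exhibit solutions, built from the
    tails of [R] evaluated at [G]. Substitution being defined by coefficients, its multiplicativity,
    associativity and chain rule are checked on single terms and extended by [t]-adic continuity.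
    Injectivity of [f |-> f(G)] also yields [G(K(z)) = z] from [K(G(z)) = z]. *)

Section NoncrossingPartitions.
Variable N : nat.
Implicit Types (V W D : {set 'I_N}) (P : {set {set 'I_N}}).

(** All partitions live in one ambient ['I_N], so the intervals produced by a split need no
    relabelling. *)
Definition NC_on D : {set {set {set 'I_N}}} :=
  [set P | partition P D &
    [forall V in P, forall W in P, (V != W) ==> ~~ crossing V W]].

Lemma NC_onP P D : reflect
  [/\ forall V, V \in P -> exists x, x \in V,
      forall V x, V \in P -> x \in V -> x \in D,
      forall x, x \in D -> exists2 V, V \in P & x \in V,
      forall V W x, V \in P -> W \in P -> x \in V -> x \in W -> V = W
    & forall V W (p q r s : 'I_N), V \in P -> W \in P ->
        p \in V -> q \in W -> r \in V -> s \in W ->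
        (p < q)%N -> (q < r)%N -> (r < s)%N -> V = W]
  (P \in NC_on D).
Proof.
rewrite inE /partition; apply: (iffP idP).
  case/andP=> /and3P[/eqP covP trP P0] /forall_inP nc; split.
  - by move=> V VP; apply/set0Pn; apply: contraNneq P0 => <-.
  - by move=> V x VP xV; rewrite -covP; apply/bigcupP; exists V.
  - by move=> x; rewrite -covP => /bigcupP[V VP xV]; exists V.
  - by move=> V W x VP WP xV xW; rewrite -(def_pblock trP VP xV) (def_pblock trP WP xW).
  - move=> V W p q r s VP WP pV qW rV sW pq qr rs.
    apply/eqP/negPn/negP => VW.
    move/forall_inP/(_ W WP)/implyP/(_ VW)/negP: (nc V VP); apply.
    apply/exists_inP; exists p => //; apply/exists_inP; exists q => //.
    apply/exists_inP; exists r => //; apply/exists_inP; exists s => //.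
    by rewrite pq qr rs.
case=> ne sub cov un cr; apply/andP; split; [apply/and3P; split|].
- rewrite eqEsubset; apply/andP; split; apply/subsetP => x.
    by case/bigcupP => V VP xV; apply: sub VP xV.
  by case/cov => V VP xV; apply/bigcupP; exists V.
- apply/trivIsetP => V W VP WP; apply: contraR => /pred0Pn[x /= /andP[xV xW]].
  by apply/eqP; apply: un xV xW.
- by apply/negP => /ne[x]; rewrite inE.
- apply/forall_inP => V VP; apply/forall_inP => W WP; apply/implyP; apply: contra.
  case/exists_inP=> p pV /exists_inP[q qW] /exists_inP[r rV] /exists_inP[s sW].
  by case/and3P => pq qr rs; apply/eqP; apply: (cr V W p q r s).
Qed.

Definition ivl (i j : nat) : {set 'I_N} := [set x : 'I_N | (i <= x < j)%N].

Lemma in_ivl i j (x : 'I_N) : (x \in ivl i j) = (i <= x < j)%N.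
Proof. by rewrite inE. Qed.

(** * Splitting at the successor of the first point *)

Section Split.
Variables (a : 'I_N) (j : nat).

Definition linked P (b : 'I_N) := [exists V in P,
  [&& a \in V, b \in V, (a < b)%N & [forall c in V, (a < c)%N ==> (b <= c)%N]]].

Lemma linkedP P (b : 'I_N) : reflect
  (exists2 V, V \in P & [/\ a \in V, b \in V, (a < b)%N &
     forall c : 'I_N, c \in V -> (a < c)%N -> (b <= c)%N]) (linked P b).
Proof.
apply: (iffP exists_inP) => -[V VP].
  case/and4P=> aV bV ab /forall_inP mb; exists V => //; split=> // c cV.
  by apply/implyP; apply: mb.
case=> aV bV ab mb; exists V => //; rewrite aV bV ab /=.
by apply/forall_inP => c cV; apply/implyP; apply: mb.
Qed.

(* The element following [a] in its block, or [a] itself if it is the last. *)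
Definition successor P : 'I_N := odflt a [pick b | linked P b].

Lemma linked_inj P b c : P \in NC_on (ivl a j) ->
  linked P b -> linked P c -> b = c.
Proof.
case/NC_onP=> _ _ _ un _ /linkedP[V VP [aV bV ab mb]] /linkedP[W WP [aW cW ac mc]].
have VW := un _ _ _ VP WP aV aW; subst W.
by apply/val_inj/eqP; rewrite /= eqn_leq mb // mc.
Qed.

Lemma successor_linked P (b : 'I_N) : P \in NC_on (ivl a j) -> (a < b)%N ->
  (successor P == b) = linked P b.
Proof.
move=> PD ab; rewrite /successor; case: pickP => [c lc|nl] /=.
  by apply/eqP/idP => [<- //|lb]; apply: linked_inj lc lb.
by rewrite nl; apply/eqP => ba; rewrite ba ltnn in ab.
Qed.

(** If no point is linked, the block of [a] has no point above [a], since the least such point would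
    be linked, and none below, [a] being the least point of the interval. *)
Lemma successor_self P : (a < j)%N -> P \in NC_on (ivl a j) ->
  (successor P == a) = ([set a] \in P).
Proof.
move=> aj PD; have [_ sub cov un _] := NC_onP _ _ PD.
rewrite /successor; case: pickP => [c /linkedP[V VP [aV cV ac _]]|nl] /=.
  apply/eqP/idP => [ca|aP]; first by rewrite ca ltnn in ac.
  move: cV ac; rewrite (un _ _ _ VP aP aV (set11 a)) inE => /eqP ->.
  by rewrite ltnn.
rewrite eqxx; symmetry; have [|V VP aV] := cov a; first by rewrite in_ivl leqnn.
suff <- : V = [set a] by [].
apply/setP => x; rewrite inE; apply/idP/eqP => [xV|-> //].
apply/eqP/negPn/negP => xa.
have ax : (a < x)%N.
  have := sub _ _ VP xV; rewrite in_ivl => /andP[le_ax _].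
  by rewrite ltn_neqAle le_ax andbT; apply: contra xa => /eqP/val_inj ->.
pose Q := [pred c : 'I_N | (c \in V) && (a < c)%N].
have Qx : Q x by rewrite /= xV.
case: (@arg_minnP _ x Q (fun c : 'I_N => c : nat) Qx) => b /andP[bV ab] mb.
have /negP[] := negbT (nl b); apply/linkedP; exists V => //; split=> // c cV ac.
by apply: mb; rewrite /= cV.
Qed.

Lemma successor_range P : (a < j)%N -> P \in NC_on (ivl a j) ->
  (a <= successor P < j)%N.
Proof.
move=> aj PD; rewrite /successor; case: pickP => [c|_] /=; last by rewrite leqnn.
case/linkedP=> V VP [aV cV ac _]; have [_ sub _ _ _] := NC_onP _ _ PD.
by have := sub _ _ VP cV; rewrite in_ivl.
Qed.

(** A singleton takes part in no crossing. The last condition excludes the [P] that already contain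
    it, for which the union changes nothing. *)
Lemma NC_on_singletonl P : (a < j)%N ->
  (P \in NC_on (ivl a.+1 j)) =
  (([set a] |: P) \in NC_on (ivl a j)) && ([set a] \notin P).
Proof.
move=> aj; apply/idP/andP.
  move=> PD; have [ne sub cov un cr] := NC_onP _ _ PD.
  have aP V : V \in P -> a \in V -> False.
    by move=> VP aV; have := sub _ _ VP aV; rewrite in_ivl ltnn.
  split; last by apply/negP => /aP; apply; apply: set11.
  apply/NC_onP; split.
  - by move=> V /setU1P[->|/ne//]; exists a; rewrite inE.
  - move=> V x /setU1P[->|VP]; first by rewrite inE => /eqP ->; rewrite in_ivl leqnn.
    by move/(sub _ _ VP); rewrite !in_ivl => /andP[/ltnW -> ->].
  - move=> x xD; have [->|xa] := eqVneq x a.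
      by exists [set a]; rewrite ?inE ?eqxx.
    have [|V VP xV] := cov x; last by exists V => //; rewrite inE VP orbT.
    by move: xD xa; rewrite !in_ivl -val_eqE /=; lia.
  - move=> V W x /setU1P[->|VP] /setU1P[->|WP] //; last exact: un.
      by rewrite inE => /eqP -> /(aP _ WP).
    by rewrite inE => xV /eqP xa; case: (aP _ VP); rewrite -xa.
  - move=> V W p q r s /setU1P[->|VP] /setU1P[->|WP] //; last exact: cr.
      by rewrite !inE => /eqP -> _ /eqP -> _; lia.
    by rewrite !inE => _ /eqP -> _ /eqP ->; lia.
case=> /NC_onP[ne sub cov un cr] naP; apply/NC_onP; split.
- by move=> V VP; apply: ne; rewrite inE VP orbT.
- move=> V x VP xV; have VP' : V \in (([set a] |: P)) by rewrite inE VP orbT.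
  have := sub _ _ VP' xV; rewrite !in_ivl leq_eqVlt => /andP[/orP[/eqP ax|-> ->] //].
  have ax' : a = x by apply: val_inj.
  by case/negP: naP; rewrite (un [set a] V a (setU11 _ _) VP' (set11 a)) ?ax'.
- move=> x; rewrite in_ivl => /andP[ax xj].
  have [|V] := cov x; first by rewrite in_ivl ltnW.
  case/setU1P=> [->|VP xV]; last by exists V.
  by rewrite inE => /eqP xa; rewrite xa ltnn in ax.
- by move=> V W x VP WP; apply: un; rewrite inE ?VP ?WP orbT.
- by move=> V W p q r s VP WP; apply: cr; rewrite inE ?VP ?WP orbT.
Qed.

(** * The bijection between linked partitions and pairs of partitions *)

Section Link.
Variable b : 'I_N.
Hypotheses (ab : (a < b)%N) (bj : (b < j)%N).

Definition join_block V : {set 'I_N} := if b \in V then (a |: V) else V.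

Definition glue (PP : {set {set 'I_N}} * {set {set 'I_N}}) :=
  (PP.1 :|: join_block @: PP.2).

(** For a linked [P], only the common block of [a] and [b] is altered: every other block lies inside
    the gap between [a] and [b] or beyond [b]. *)
Definition cut P :=
  ([set V in P | V \subset ivl a.+1 b],
   [set (V :\ a) | V in P & ~~ (V \subset ivl a.+1 b)]).

Lemma in_join_block V (x : 'I_N) :
  (x \in join_block V) = (x == a) && (b \in V) || (x \in V).
Proof. by rewrite /join_block; case: ifP; rewrite ?andbT ?andbF ?inE. Qed.

Lemma join_blockK P V : P \in NC_on (ivl b j) -> V \in P ->
  (join_block V :\ a) = V.
Proof.
case/NC_onP=> _ sub _ _ _ VP; apply/setP => x; rewrite in_setD1 in_join_block.
have [->|//] := eqVneq x a; symmetry; apply/negP => /(sub _ _ VP).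
by rewrite in_ivl; lia.
Qed.

Lemma join_block_sub P V : P \in NC_on (ivl b j) -> V \in P ->
  (join_block V \subset ivl a.+1 b) = false.
Proof.
case/NC_onP=> ne sub _ _ _ VP; apply/negP => /subsetP sV.
have [x xV] := ne _ VP.
have := sV x; rewrite in_join_block xV orbT => /(_ isT); have := sub _ _ VP xV.
by rewrite !in_ivl; lia.
Qed.

Lemma glueK P1 P2 : P1 \in NC_on (ivl a.+1 b) -> P2 \in NC_on (ivl b j) ->
  cut (glue (P1, P2)) = (P1, P2).
Proof.
move=> PD1 PD2; have [_ sub1 _ _ _] := NC_onP _ _ PD1.
have sP1 V : V \in P1 -> V \subset ivl a.+1 b.
  by move=> VP; apply/subsetP => x; apply: sub1.
congr pair; apply/setP => V; rewrite ?inE /=.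
  apply/idP/idP => [/andP[/orP[//|/imsetP[W WP ->]]]|VP].
    by rewrite (join_block_sub PD2 WP).
  by rewrite VP sP1.
apply/imsetP/idP => [[W]|VP].
  rewrite !inE => /andP[/orP[/sP1 ->//|/imsetP[U UP ->]] _ ->].
  by rewrite (join_blockK PD2 UP).
exists (join_block V); last by rewrite (join_blockK PD2 VP).
by rewrite inE (join_block_sub PD2 VP) andbT inE imset_f ?orbT.
Qed.

Lemma glue_NC P1 P2 : P1 \in NC_on (ivl a.+1 b) -> P2 \in NC_on (ivl b j) ->
  (glue (P1, P2) \in NC_on (ivl a j)) && linked (glue (P1, P2)) b.
Proof.
case/NC_onP=> ne1 sub1 cov1 un1 cr1 /NC_onP[ne2 sub2 cov2 un2 cr2].
have sb1 V (x : 'I_N) : V \in P1 -> x \in V -> (a < x < b)%N.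
  by move=> VP xV; have := sub1 _ _ VP xV; rewrite in_ivl.
have sb2 V (x : 'I_N) : V \in P2 -> x \in V -> (b <= x < j)%N.
  by move=> VP xV; have := sub2 _ _ VP xV; rewrite in_ivl.
have sj V (x : 'I_N) : V \in P2 -> x \in join_block V -> x = a \/ (b <= x)%N.
  move=> VP; rewrite in_join_block => /orP[/andP[/eqP -> _]|/(sb2 _ _ VP)/andP[]].
    by left.
  by right.
have sj' V (x : 'I_N) : x \in join_block V -> (a < x)%N -> x \in V.
  by rewrite in_join_block => /orP[/andP[/eqP -> _]|//]; rewrite ltnn.
have [|B BP bB] := cov2 b; first by rewrite in_ivl leqnn.
apply/andP; split.
  apply/NC_onP; split.
  - move=> V /setUP[/ne1//|/imsetP[W WP ->]]; have [x xW] := ne2 _ WP.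
    by exists x; rewrite in_join_block xW orbT.
  - move=> V x /setUP[VP /(sb1 _ _ VP)|/imsetP[W WP ->]]; first by rewrite in_ivl; lia.
    rewrite in_join_block => /orP[/andP[/eqP -> _]|/(sb2 _ _ WP)]; rewrite in_ivl; lia.
  - move=> x; rewrite in_ivl => /andP[ax xj].
    have [xb|bx] := ltnP x b; last first.
      have [|V VP xV] := cov2 x; first by rewrite in_ivl bx.
      exists (join_block V); last by rewrite in_join_block xV orbT.
      by rewrite inE imset_f ?orbT.
    have [xa|xa] := eqVneq x a.
      exists (join_block B); last by rewrite in_join_block xa eqxx bB.
      by rewrite inE imset_f ?orbT.
    have [|V VP xV] := cov1 x; last by exists V => //; rewrite inE VP.
    by move: xa; rewrite in_ivl xb andbT -val_eqE /=; lia.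
  - move=> V W x /setUP[VP|/imsetP[V' VP ->]] /setUP[WP|/imsetP[W' WP ->]].
    + exact: un1.
    + by move=> /(sb1 _ _ VP) xV /(sj _ _ WP)[xa|]; rewrite ?xa in xV *; lia.
    + by move=> xV /(sb1 _ _ WP) xW; case: (sj _ _ VP xV) => [xa|];
        rewrite ?xa in xW *; lia.
    + rewrite !in_join_block => /orP[/andP[/eqP -> bV]|xV] /orP[/andP[/eqP xa bW]|xW].
      * by rewrite (un2 _ _ _ VP WP bV bW).
      * by have := sb2 _ _ WP xW; lia.
      * by have := sb2 _ _ VP xV; rewrite xa; lia.
      * by rewrite (un2 _ _ _ VP WP xV xW).
  - move=> V W p q r s /setUP[VP|/imsetP[V' VP ->]] /setUP[WP|/imsetP[W' WP ->]].
    + exact: cr1.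
    + move=> /(sb1 _ _ VP) pV /(sj _ _ WP)[qa|qb] /(sb1 _ _ VP) rV; rewrite ?qa; lia.
    + move=> _ /(sb1 _ _ WP) qW /(sj _ _ VP)[ra|rb] /(sb1 _ _ WP) sW; rewrite ?ra; lia.
    + move=> pV qW rV sW pq qr rs.
      (* Both blocks come from [P2]. Since [a <= p < q], only [p] can be the added point [a]. *)
      have ap : (a <= p)%N by case: (sj _ _ VP pV) => [-> //|]; apply/leq_trans/ltnW.
      have {}qW := sj' _ _ qW (leq_ltn_trans ap pq).
      have {}rV := sj' _ _ rV (ltn_trans (leq_ltn_trans ap pq) qr).
      have {}sW := sj' _ _ sW (ltn_trans (ltn_trans (leq_ltn_trans ap pq) qr) rs).
      suff -> : V' = W' by [].
      (* If [p] is [a], its block contains [b], which takes the place of [p]: either [b] is [q] and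
         the blocks meet, or [b], [q], [r], [s] alternate. *)
      move: pV; rewrite in_join_block => /orP[/andP[_ bV]|pV]; last exact: (cr2 _ _ p q r s).
      have [bq|bq] := eqVneq b q; first by apply: (un2 _ _ b) => //; rewrite bq.
      apply: (cr2 _ _ b q r s) => //.
      by rewrite ltn_neqAle bq; have /andP[] := sb2 _ _ WP qW.
apply/linkedP; exists (join_block B); first by rewrite inE imset_f ?orbT.
split=> //; rewrite ?in_join_block ?eqxx ?bB ?orbT // => c cB ac.
by have /andP[] := sb2 _ _ BP (sj' _ _ cB ac).
Qed.

Lemma cut_NC P : P \in NC_on (ivl a j) -> linked P b ->
  [/\ (cut P).1 \in NC_on (ivl a.+1 b), (cut P).2 \in NC_on (ivl b j)
    & glue (cut P) = P].
Proof.
move=> /NC_onP[ne sub cov un cr] /linkedP[B BP [aB bB _ mb]].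
(* A block meeting the gap is not [B], by minimality of [b]; a point [y] of it beyond [b] would make
   [a], [x], [b], [y] alternate between [B] and that block. *)
have in1 V (x : 'I_N) : V \in P -> x \in V -> (a < x < b)%N -> V \subset ivl a.+1 b.
  move=> VP xV axb; apply/subsetP => y yV.
  have VB : V <> B by move=> VB; have := mb x; rewrite -VB xV => /(_ isT); lia.
  have ya : y <> a by move=> ya; apply: VB; apply: (un _ _ a) => //; rewrite -ya.
  have yb : y <> b by move=> yb; apply: VB; apply: (un _ _ b) => //; rewrite -yb.
  have := sub _ _ VP yV; rewrite !in_ivl => /andP[ay yj].
  have ay' : (a < y)%N by rewrite ltn_neqAle ay andbT; apply/eqP => /val_inj /esym.
  rewrite ay' /= ltnNge; apply/negP => le_by; apply: VB.
  have lt_by : (b < y)%N by rewrite ltn_neqAle le_by andbT; apply/eqP => /val_inj /esym.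
  by symmetry; apply: (cr _ _ a x b y) => //; case/andP: axb.
(* A block contains [a] exactly when it contains [b], both lying in [B], so [join_block] restores
   what was removed. *)
have jK V : V \in P -> join_block (V :\ a) = V.
  move=> VP; apply/setP => x; rewrite in_join_block !in_setD1.
  have -> : b != a by rewrite -val_eqE /= gtn_eqF.
  have [->|//] := eqVneq x a; rewrite /= orbF.
  by apply/idP/idP => [bV|aV]; [rewrite (un _ _ _ VP BP bV bB)|rewrite (un _ _ _ VP BP aV aB)].
split.
- apply/NC_onP; split=> /=.
  + by move=> V; rewrite inE => /andP[/ne].
  + by move=> V x; rewrite inE => /andP[VP /subsetP]; apply.
  + move=> x; rewrite in_ivl => /andP[ax xb].
    have [|V VP xV] := cov x; first by rewrite in_ivl ltnW //= (ltn_trans xb).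
    by exists V => //; rewrite inE VP (in1 _ x) ?ax.
  + by move=> V W x; rewrite !inE => /andP[VP _] /andP[WP _]; apply: un.
  + by move=> V W p q r s; rewrite !inE => /andP[VP _] /andP[WP _]; apply: cr.
- apply/NC_onP; split=> /=.
  + move=> V /imsetP[W]; rewrite inE => /andP[WP /subsetPn[x xW xD]] ->.
    have [xa|xa] := eqVneq x a; last by exists x; rewrite in_setD1 xa.
    exists b; rewrite in_setD1 -val_eqE /= gtn_eqF //=.
    by rewrite (un _ _ a WP BP) // -xa.
  + move=> V x /imsetP[W]; rewrite inE => /andP[WP sW] ->.
    rewrite in_setD1 => /andP[xa xW]; have := sub _ _ WP xW.
    rewrite !in_ivl => /andP[ax ->]; rewrite andbT leqNgt; apply: contra sW => xb.
    by apply: (in1 _ x) => //; rewrite xb andbT ltn_neqAle ax andbT eq_sym.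
  + move=> x; rewrite in_ivl => /andP[bx xj].
    have [|V VP xV] := cov x; first by rewrite in_ivl xj andbT ltnW // (leq_trans ab).
    exists (V :\ a); last first.
      by rewrite in_setD1 xV andbT -val_eqE /= gtn_eqF // (leq_trans ab).
    apply/imset_f; rewrite inE VP; apply/negP => /subsetP/(_ _ xV).
    by rewrite in_ivl; lia.
  + move=> _ _ x /imsetP[V + ->] /imsetP[W + ->]; rewrite !inE.
    by move=> /andP[VP _] /andP[WP _] /andP[_ xV] /andP[_ xW]; rewrite (un _ _ _ VP WP xV xW).
  + move=> _ _ p q r s /imsetP[V + ->] /imsetP[W + ->]; rewrite !inE.
    move=> /andP[VP _] /andP[WP _] /andP[_ pV] /andP[_ qW] /andP[_ rV] /andP[_ sW] *.
    by rewrite (cr V W p q r s).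
- apply/setP => V; rewrite !inE; apply/orP/idP => [[/andP[]//|]|VP].
    by case/imsetP=> _ /imsetP[W + ->] ->; rewrite inE => /andP[WP _]; rewrite jK.
  case: (boolP (V \subset ivl a.+1 b)) => sV; [left|right]; first by rewrite VP.
  apply/imsetP; exists (V :\ a); last by rewrite jK.
  by apply/imset_f; rewrite inE VP.
Qed.

End Link.

(** * Weighted sums over partitions *)

Variables (A : comPzRingType) (w : {set 'I_N} -> A).

(** The sum is reindexed along [glue]. The product over a glued partition factors because joined
    blocks never lie in the gap, so the two families of blocks are disjoint. *)
Lemma sum_NC_linked (b : 'I_N) : (a < b)%N -> (b < j)%N ->
  \sum_(P in NC_on (ivl a j) | linked P b) \prod_(V in P) w V =
  (\sum_(P in NC_on (ivl a.+1 b)) \prod_(V in P) w V) *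
  (\sum_(P in NC_on (ivl b j)) \prod_(V in P) w (join_block b V)).
Proof.
move=> ab bj; rewrite big_distrlr /= pair_big /=.
rewrite (reindex_onto (glue b) (cut b)) /=; last first.
  by move=> P /andP[PD lP]; have [_ _ ->] := cut_NC ab bj PD lP.
apply: eq_big => [[P1 P2]|[P1 P2]] /=.
  apply/idP/idP => [/andP[/andP[PD lP] /eqP gP]|/andP[PD1 PD2]].
    by have [] := cut_NC ab bj PD lP; rewrite gP /= => -> ->.
  by rewrite glue_NC // (glueK ab bj PD1 PD2) eqxx.
move=> /andP[/andP[PD lP] /eqP gP].
have [PD1 PD2 _] := cut_NC ab bj PD lP; rewrite gP /= in PD1 PD2.
have inj : {in P2 &, injective (join_block b)}.
  by move=> V W VP WP VW; rewrite -(join_blockK ab bj PD2 VP) VW (join_blockK ab bj PD2 WP).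
rewrite /glue /= (eq_bigl [in [predU P1 & join_block b @: P2]]); last first.
  by move=> V; rewrite !inE.
rewrite bigU /=; first by rewrite (big_imset _ inj).
rewrite -setI_eq0; apply/eqP/setP => V; rewrite !inE; apply/negP => /andP[VP].
case/imsetP=> W WP VW; have := join_block_sub ab bj PD2 WP; rewrite -VW => /negP[].
by have [_ sub1 _ _ _] := NC_onP _ _ PD1; apply/subsetP => x; apply: sub1.
Qed.

Lemma sum_NC_singleton : (a < j)%N ->
  \sum_(P in NC_on (ivl a j) | [set a] \in P) \prod_(V in P) w V =
  w [set a] * \sum_(P in NC_on (ivl a.+1 j)) \prod_(V in P) w V.
Proof.
move=> aj; rewrite big_distrr /=.
rewrite (reindex_onto (fun P => [set a] |: P) (fun P => P :\ [set a])) /=; last first.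
  by move=> P /andP[_ aP]; rewrite setD1K.
apply: eq_big => [P|P].
  rewrite (NC_on_singletonl _ aj) setU11 andbT; congr andb.
  apply/eqP/idP => [<-|naP]; first by rewrite !inE eqxx.
  by rewrite setU1K.
by move=> /andP[_ /eqP eP]; rewrite big_setU1 //= -eP !inE eqxx.
Qed.

(** Partitions are sorted by the successor of [a]: the value [a] is the singleton case, any other
    value the linked case. *)
Lemma sum_NC_split : (a < j)%N ->
  \sum_(P in NC_on (ivl a j)) \prod_(V in P) w V =
  w [set a] * (\sum_(P in NC_on (ivl a.+1 j)) \prod_(V in P) w V) +
  \sum_(b : 'I_N | (a < b < j)%N)
    (\sum_(P in NC_on (ivl a.+1 b)) \prod_(V in P) w V) *
    (\sum_(P in NC_on (ivl b j)) \prod_(V in P) w (join_block b V)).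
Proof.
move=> aj; rewrite (partition_big successor (fun b : 'I_N => (a <= b < j)%N)) /=; last first.
  by move=> P; apply: successor_range.
rewrite (bigD1 a) ?leqnn //=; congr (_ + _).
  rewrite -sum_NC_singleton //; apply: eq_bigl => P.
  by case: (boolP (P \in _)) => //= PD; rewrite successor_self.
apply: eq_big => [b|b /andP[/andP[ab bj] nb]].
  by rewrite -val_eqE /= andbAC [in RHS]ltn_neqAle [(val a == _)]eq_sym [(_ != _) && _]andbC.
have {nb}ab' : (a < b)%N by rewrite ltn_neqAle ab andbT eq_sym.
rewrite -sum_NC_linked //; apply: eq_bigl => P.
by case: (boolP (P \in _)) => //= PD; rewrite successor_linked.
Qed.

End Split.
End NoncrossingPartitions.

(** * The moment-cumulant recursion *)

Section MomentRecursion.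
Variables (A : comPzRingType) (kappa : nat -> A).

(** The point [i] is a number, not an element of ['I_N], so that an empty interval at the end of the
    range makes sense. *)
Definition shifted_weight N (i s : nat) (V : {set 'I_N}) : A :=
  kappa (#|V| + s * [exists x in V, x == i :> nat])%N.

Definition shifted_moment N (i j s : nat) : A :=
  \sum_(P in NC_on (ivl N i j)) \prod_(V in P) shifted_weight i s V.

Lemma shifted_weight0 N i (V : {set 'I_N}) : shifted_weight i 0 V = kappa #|V|.
Proof. by rewrite /shifted_weight mul0n addn0. Qed.

Lemma shifted_weight_in N (x : 'I_N) s (V : {set 'I_N}) :
  x \in V -> shifted_weight x s V = kappa (#|V| + s)%N.
Proof.
move=> xV; rewrite /shifted_weight; suff -> : [exists y in V, y == x :> nat] by rewrite muln1.
by apply/exists_inP; exists x.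
Qed.

Lemma shifted_weight_out N (x : 'I_N) s (V : {set 'I_N}) :
  x \notin V -> shifted_weight x s V = kappa #|V|.
Proof.
move=> xV; rewrite /shifted_weight; suff /negPf -> : ~~ [exists y in V, y == x :> nat].
  by rewrite muln0 addn0.
by apply: contra xV => /exists_inP[y yV /eqP/val_inj <-].
Qed.

Lemma shifted_moment_empty N i s : shifted_moment N i i s = 1.
Proof.
have D0 : ivl N i i = set0.
  by apply/setP => x; rewrite in_ivl inE; apply/negP => /andP[ix]; rewrite ltnNge ix.
rewrite /shifted_moment (big_pred1 set0) ?big_set0 // => P /=.
rewrite D0 inE partition_set0; case: eqP => //= ->.
by apply/forall_inP => V; rewrite inE.
Qed.

(** The singleton has weight [kappa (1 + s)]. Joining [a] to the block of [b] raises its size by one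
    and hands over the shift [s], which amounts to the shift [s.+1] at [b]; all other blocks keep
    their plain weight. *)
Lemma shifted_moment_rec N i j s : (i < j)%N -> (j <= N)%N ->
  shifted_moment N i j s = kappa s.+1 * shifted_moment N i.+1 j 0 +
  \sum_(i.+1 <= b < j) shifted_moment N i.+1 b 0 * shifted_moment N b j s.+1.
Proof.
move=> ij jN; pose a := Ordinal (leq_trans ij jN).
have notin k P V : P \in NC_on (ivl N k j) -> (i < k)%N -> V \in P -> a \notin V.
  case/NC_onP=> _ sub _ _ _ ik VP; apply/negP => /(sub _ _ VP).
  by rewrite in_ivl /= leqNgt ik.
rewrite {1}/shifted_moment (@sum_NC_split _ a) //; congr (_ * _ + _).
- by rewrite (@shifted_weight_in _ a) ?set11 // cards1.
- apply: eq_bigr => P PD; apply: eq_bigr => V VP.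
  by rewrite shifted_weight0 (@shifted_weight_out _ a) // (notin _ _ _ PD).
rewrite big_geq_mkord (big_ord_widen_cond N (fun b => (i < b)%N)
  (fun b => shifted_moment N i.+1 b 0 * shifted_moment N b j s.+1)) //=.
apply: eq_bigr => b /andP[ib bj]; congr (_ * _); apply: eq_bigr => P PD; apply: eq_bigr => V VP.
  have aV : a \notin V.
    have [_ sub _ _ _] := NC_onP _ _ PD; apply/negP => /(sub _ _ VP).
    by rewrite in_ivl ltnn.
  by rewrite shifted_weight0 (@shifted_weight_out _ a).
have aV := notin _ _ _ PD ib VP.
rewrite /join_block; case: ifPn => bV; last first.
  by rewrite (@shifted_weight_out _ a) // shifted_weight_out.
by rewrite (@shifted_weight_in _ a) ?setU11 // shifted_weight_in // cardsU1 aV addnS.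
Qed.

(** Every interval is written as start plus length, the form required by an induction on the
    length. *)
Lemma shifted_moment_recD N i k s : (i + k < N)%N ->
  shifted_moment N i (i + k.+1) s =
  kappa s.+1 * shifted_moment N i.+1 (i.+1 + k) 0 +
  \sum_(l < k) shifted_moment N i.+1 (i.+1 + l) 0 *
    shifted_moment N (i.+1 + l) (i.+1 + l + (k - l.+1).+1) s.+1.
Proof.
move=> iN; rewrite shifted_moment_rec; [|lia|lia]; congr (_ * _ + _).
  by rewrite addSnnS.
have -> : (i + k.+1 = k + i.+1)%N by lia.
rewrite -{1}[i.+1]add0n big_addn addnK big_mkord; apply: eq_bigr => l _.
by rewrite addnC; congr (_ * shifted_moment _ _ _ _); have := ltn_ord l; lia.
Qed.

Lemma shifted_moment_translate k : forall s N N' i i', (i + k <= N)%N ->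
  (i' + k <= N')%N -> shifted_moment N i (i + k) s = shifted_moment N' i' (i' + k) s.
Proof.
elim/ltn_ind: k => -[|k] IHk s N N' i i' iN iN'; first by rewrite !addn0 !shifted_moment_empty.
rewrite !shifted_moment_recD; [|lia|lia]; congr (_ * _ + _).
  by apply: IHk; lia.
by apply: eq_bigr => l _; have := ltn_ord l => lk; congr (_ * _); apply: IHk; lia.
Qed.

Definition nc_moment n : A := \sum_(P in NC n) \prod_(V in P) kappa #|V|.

(* The sum over [NC n.+1] in which the block of the first point counts for
   [s] more points than it has. *)
Definition nc_shifted n s : A := shifted_moment n.+1 0 n.+1 s.

Lemma nc_momentE n : nc_moment n = shifted_moment n 0 n 0.
Proof.
have NCE : NC n = NC_on (ivl n 0 n).
  suff -> : ivl n 0 n = setT by [].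
  by apply/setP => x; rewrite in_ivl inE ltn_ord.
rewrite /nc_moment /shifted_moment -NCE; apply: eq_bigr => P _.
by apply: eq_bigr => V _; rewrite shifted_weight0.
Qed.

Lemma nc_moment0 : nc_moment 0 = 1.
Proof. by rewrite nc_momentE shifted_moment_empty. Qed.

Lemma nc_momentS n : nc_moment n.+1 = nc_shifted n 0.
Proof. exact: nc_momentE. Qed.

(** Here [l] counts the points strictly between the first two points of the first block. From the
    second of these on, [n - l = (n - l.+1).+1] points remain, and [nc_shifted] covers one point
    more than its argument. *)
Lemma nc_shifted_rec n s : nc_shifted n s =
  kappa s.+1 * nc_moment n + \sum_(l < n) nc_moment l * nc_shifted (n - l.+1) s.+1.
Proof.
rewrite /nc_shifted -[n.+1 in X in shifted_moment _ _ X _]add0n shifted_moment_recD //.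
rewrite nc_momentE; congr (_ * _ + _).
  by rewrite -[in RHS](add0n n); apply: shifted_moment_translate; lia.
apply: eq_bigr => l _; have := ltn_ord l => ln; rewrite nc_momentE; congr (_ * _).
  by rewrite -[in RHS](add0n l); apply: shifted_moment_translate; lia.
rewrite -[(n - l.+1).+1 in X in _ = shifted_moment _ _ X _]add0n.
by apply: shifted_moment_translate; lia.
Qed.

End MomentRecursion.

(** * First order variation of the recursion *)

Section InfinitesimalRecursion.
Variables (F : fieldType) (kappa kappa' : nat -> F).

(* Sums over non-crossing partitions are evaluated on the cumulants
   [kappa + kappa' X]; only the two lowest coefficients matter, so that [X] plays
   the role of an infinitesimal. *)
Definition inf_weight n : {poly F} := (kappa n)%:P + (kappa' n)%:P * 'X.

Lemma coef0_inf_weight n : (inf_weight n)`_0 = kappa n.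
Proof. by rewrite coefD coefC coefMX addr0. Qed.

Lemma coef1_inf_weight n : (inf_weight n)`_1 = kappa' n.
Proof. by rewrite coefD coefC coefMX coefC add0r. Qed.

Lemma coef1M (p q : {poly F}) : (p * q)`_1 = p`_1 * q`_0 + p`_0 * q`_1.
Proof. by rewrite coefM !big_ord_recl big_ord0 /= addr0 addrC. Qed.

(** Leibniz rule at [X = 0], where the coefficient of [X] is the derivative. *)
Lemma coef1_prod (I : finType) (S : {set I}) (f : I -> {poly F}) :
  (\prod_(i in S) f i)`_1 =
  \sum_(i in S) (f i)`_1 * \prod_(k in S | k != i) (f k)`_0.
Proof.
elim/ltn_ind: {S}#|S| {-2}S (erefl #|S|) => n IHn S Sn.
have [->|[x xS]] := set_0Vmem S; first by rewrite !big_set0 coef1.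
rewrite (big_setD1 x) //= coef1M (IHn #|S :\ x|) //; last first.
  by rewrite -Sn (cardsD1 x S) xS.
rewrite [RHS](big_setD1 x) //= coef0_prod; congr (_ * _ + _).
  by apply: eq_bigl => k; rewrite !inE andbC.
rewrite big_distrr /=; apply: eq_bigr => i; rewrite !inE => /andP[ix iS].
rewrite [in RHS](bigD1 x) /=; last by rewrite xS eq_sym.
rewrite mulrCA; congr (_ * (_ * _)); apply: eq_bigl => k; rewrite !inE.
by case: (k \in S); case: (k == x); case: (k == i).
Qed.

Lemma coef0_nc_shifted n s : (nc_shifted inf_weight n s)`_0 = nc_shifted kappa n s.
Proof.
rewrite coef_sum; apply: eq_bigr => P _; rewrite coef0_prod.
by apply: eq_bigr => V _; rewrite coef0_inf_weight.
Qed.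

Lemma coef0_nc_moment n : (nc_moment inf_weight n)`_0 = nc_moment kappa n.
Proof.
rewrite coef_sum; apply: eq_bigr => P _; rewrite coef0_prod.
by apply: eq_bigr => V _; rewrite coef0_inf_weight.
Qed.

Definition inf_nc_moment n : F := (nc_moment inf_weight n)`_1.
Definition inf_nc_shifted n s : F := (nc_shifted inf_weight n s)`_1.

Lemma inf_nc_momentE n : inf_nc_moment n =
  \sum_(P in NC n) \sum_(V in P) kappa' #|V| * \prod_(W in P | W != V) kappa #|W|.
Proof.
rewrite /inf_nc_moment coef_sum; apply: eq_bigr => P _.
rewrite coef1_prod; apply: eq_bigr => V _; rewrite coef1_inf_weight.
by congr (_ * _); apply: eq_bigr => W _; rewrite coef0_inf_weight.
Qed.

Lemma inf_nc_moment0 : inf_nc_moment 0 = 0.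
Proof. by rewrite /inf_nc_moment nc_moment0 coef1. Qed.

Lemma inf_nc_momentS n : inf_nc_moment n.+1 = inf_nc_shifted n 0.
Proof. by rewrite /inf_nc_moment nc_momentS. Qed.

(** This is the coefficient of [X] in [nc_shifted_rec], which holds over any commutative ring; no
    second combinatorial argument is needed. *)
Lemma inf_nc_shifted_rec n s : inf_nc_shifted n s =
  kappa' s.+1 * nc_moment kappa n + kappa s.+1 * inf_nc_moment n +
  \sum_(l < n) (inf_nc_moment l * nc_shifted kappa (n - l.+1) s.+1 +
                nc_moment kappa l * inf_nc_shifted (n - l.+1) s.+1).
Proof.
rewrite /inf_nc_shifted nc_shifted_rec coefD coef_sum coef1M.
rewrite coef0_inf_weight coef1_inf_weight coef0_nc_moment; congr (_ + _).
by apply: eq_bigr => l _; rewrite coef1M coef0_nc_moment coef0_nc_shifted.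
Qed.

End InfinitesimalRecursion.

(* Imported only here, because [classical_sets] shadows names of [finset]. *)
From mathcomp Require Import boolp classical_sets functions cardinality fsbigop.
From mathcomp Require Import reals.
From mathcomp.real_closed Require Import complex.

(** * Composition of Laurent series *)

Section LaurentComposition.
Variable F : fieldType.
Implicit Types (f g h : laurent F) (phi psi : laurent F -> laurent F).

Lemma lcoefD f g k : (f + g) k = f k + g k. Proof. by []. Qed.
Lemma lcoefN f k : (- f) k = - f k. Proof. by []. Qed.
Lemma lcoefB f g k : (f - g) k = f k - g k. Proof. by []. Qed.
Lemma lcoef1 k : (1 : laurent F) k = (k == 0)%:R. Proof. by []. Qed.

Lemma lmul_below M N f g : vanishes_below M f -> vanishes_below N g ->
  vanishes_below (M + N) (f * g).
Proof. exact: lconv_below. Qed.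

Lemma lmul_lead M N f g : vanishes_below M f -> vanishes_below N g ->
  (f * g) (M + N) = f M * g N.
Proof.
move=> fM gN; have := lconvE 0 fM gN; rewrite add0r => fgE.
by rewrite -[LHS]/(lconv f g (M + N)) fgE coef0M !coef_ltrunc // !add0r.
Qed.

Lemma ladd_below N f g : vanishes_below N f -> vanishes_below N g ->
  vanishes_below N (f + g).
Proof. by move=> fN gN k kN; rewrite lcoefD fN ?gN ?addr0. Qed.

Lemma lsub_below N f g : vanishes_below N f -> vanishes_below N g ->
  vanishes_below N (f - g).
Proof. by move=> fN gN k kN; rewrite lcoefB fN ?gN ?subr0. Qed.

Lemma lone_below : vanishes_below 0 (1 : laurent F).
Proof. by move=> k k0; rewrite lcoef1 lt_eqF. Qed.

Lemma lexp_below N f n : vanishes_below N f -> vanishes_below (N *+ n) (f ^+ n).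
Proof.
move=> fN; elim: n => [|n IHn]; first exact: lone_below.
by rewrite exprS mulrS; apply: lmul_below.
Qed.

(** A lower bound that is too small improves by one: [f N] times the lowest coefficient of [f^-1] is
    a coefficient of [1] at a negative exponent, hence zero. *)
Lemma linv_below N f : vanishes_below N f -> f N != 0 ->
  vanishes_below (- N) (f^-1)%R.
Proof.
move=> fN fN0; have [B gB] := lcoef_bounded f^-1.
have f0 : f != 0 by apply: contraNneq fN0 => ->.
suff IH n : vanishes_below (- N - n%:Z) (f^-1)%R -> vanishes_below (- N) (f^-1)%R.
  by apply: (IH `|- N - B|%N); apply: vanishes_belowW gB; lia.
elim: n => [|n IHn] gn; first by rewrite subr0 in gn.
apply: IHn => k kn; have [kn'|kn'] := ltP k (- N - n.+1%:Z); first exact: gn.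
have {kn kn'}-> : k = - N - n.+1%:Z by lia.
have := lmul_lead fN gn; rewrite divff // lcoef1.
rewrite (_ : (_ == 0) = false); last by lia.
by move/eqP; rewrite eq_sym mulf_eq0 (negPf fN0) => /eqP.
Qed.

Fact lterm_subproof (c : F) (n : int) :
  exists N, vanishes_below N (fun k => if k == n then c else 0).
Proof. by exists n => k kn; rewrite lt_eqF. Qed.
Definition lterm c n := Laurent (lterm_subproof c n).

Lemma lterm_below c n : vanishes_below n (lterm c n).
Proof. by move=> k kn /=; rewrite lt_eqF. Qed.

Lemma lterm0 n : lterm 0 n = 0.
Proof. by apply/laurentP => k /=; rewrite if_same. Qed.

Lemma lmonomE n : lmonom F n = lterm 1 n.
Proof. by apply/laurentP => k /=; case: eqP. Qed.

Lemma lcoef_ltermM c n f k : (lterm c n * f) k = c * f (k - n).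
Proof.
rewrite -[LHS]/(lconv (lterm c n) f k) /lconv (fsbigE [:: n]) //.
  by rewrite big_cons big_nil in_setT /= eqxx addr0.
by move=> i _; rewrite inE /= => /negPf ->; rewrite mul0r.
Qed.

Lemma lcoef_lmonomM n f k : (lmonom F n * f) k = f (k - n).
Proof. by rewrite lmonomE lcoef_ltermM mul1r. Qed.

Lemma ltermM c1 n1 c2 n2 : lterm c1 n1 * lterm c2 n2 = lterm (c1 * c2) (n1 + n2).
Proof.
apply/laurentP => k; rewrite lcoef_ltermM /=.
by rewrite (addrC n1) -subr_eq; case: eqP; rewrite ?mulr0.
Qed.

Lemma lmonomM m n : lmonom F m * lmonom F n = lmonom F (m + n).
Proof. by rewrite !lmonomE ltermM mulr1. Qed.

Lemma lmonom0 : lmonom F 0 = 1. Proof. by []. Qed.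

Lemma lmonom_neq0 n : lmonom F n != 0.
Proof. by apply/eqP => /laurentP/(_ n) /= /eqP; rewrite eqxx oner_eq0. Qed.

Lemma lmonomV n : (lmonom F n)^-1 = lmonom F (- n).
Proof.
by apply: (mulfI (lmonom_neq0 n)); rewrite divff ?lmonom_neq0 // lmonomM subrr.
Qed.

Lemma lmonomX n (k : nat) : lmonom F n ^+ k = lmonom F (n *+ k).
Proof. by elim: k => [//|k IHk]; rewrite exprS IHk lmonomM mulrS. Qed.

Lemma lmonomXz (k : int) : lmonom F 1 ^ k = lmonom F k.
Proof.
case: k => k; first by rewrite -exprnP lmonomX; congr lmonom; lia.
by rewrite NegzE -exprnN lmonomX lmonomV; congr lmonom; lia.
Qed.

Lemma ltermE c n : lterm c n = lterm c 0 * lmonom F n.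
Proof. by rewrite lmonomE ltermM mulr1 add0r. Qed.

(* Continuity for the t-adic topology, for additive maps. *)
Definition lcontinuous phi := forall n : int, exists m : int,
  forall f, vanishes_below m f -> vanishes_below n (phi f).

(** Removing lowest terms one by one, on which the maps agree, leads after finitely many steps to a
    remainder of order so high that both images vanish at [j]. *)
Lemma additive_lcontinuous_eq phi psi :
  {morph phi : f g / f + g} -> {morph psi : f g / f + g} ->
  lcontinuous phi -> lcontinuous psi ->
  (forall c n, phi (lterm c n) = psi (lterm c n)) -> phi =1 psi.
Proof.
move=> phiD psiD phiC psiC eq_term f; apply/laurentP => j.
have [m1 phi0] := phiC (j + 1); have [m2 psi0] := psiC (j + 1).
pose m := Order.max m1 m2.
suff IH n : forall f, vanishes_below (m - n%:Z) f -> phi f j = psi f j.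
  have [N fN] := lcoef_bounded f.
  by apply: (IH `|m - N|%N); apply: vanishes_belowW fN; lia.
elim: n => [|n IHn] {}f fn.
  rewrite subr0 in fn; rewrite phi0 ?psi0 ?ltzD1 //.
    by apply: vanishes_belowW fn; rewrite le_max lexx orbT.
  by apply: vanishes_belowW fn; rewrite le_max lexx.
pose k := m - n.+1%:Z.
rewrite -(subrK (lterm (f k) k) f) phiD psiD !lcoefD eq_term; congr (_ + _).
apply: IHn => i ik; rewrite lcoefB /=; have [->|nik] := eqVneq i k; first by rewrite subrr.
by rewrite fn ?subr0 //; move: nik ik; rewrite /k; lia.
Qed.

Lemma lcontinuous_comp phi psi : lcontinuous phi -> lcontinuous psi ->
  lcontinuous (phi \o psi).
Proof.
move=> phiC psiC n; have [m phi0] := phiC n; have [l psi0] := psiC m.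
by exists l => f fl; apply/phi0/psi0.
Qed.

Lemma lcontinuous_mulr g : lcontinuous (fun f => f * g).
Proof.
move=> n; have [N gN] := lcoef_bounded g; exists (n - N) => f fn.
by rewrite -(subrK N n); apply: lmul_below.
Qed.

Lemma lcontinuous_mull g : lcontinuous (fun f => g * f).
Proof.
move=> n; have [m mP] := lcontinuous_mulr g n.
by exists m => f fm; rewrite mulrC; apply: mP.
Qed.

Lemma lcontinuousD phi psi : lcontinuous phi -> lcontinuous psi ->
  lcontinuous (fun f => phi f + psi f).
Proof.
move=> phiC psiC n; have [m phi0] := phiC n; have [l psi0] := psiC n.
exists (Order.max m l) => f fml; apply: ladd_below.
  by apply: phi0; apply: vanishes_belowW fml; rewrite le_max lexx.
by apply: psi0; apply: vanishes_belowW fml; rewrite le_max lexx orbT.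
Qed.

(** * Substitution of a series of positive order *)

Section Substitution.
Variable h : laurent F.
Hypotheses (h0 : h != 0) (h1 : vanishes_below 1 h).

(** Exponents from [n + N] on are nonnegative, so the corresponding powers of [h] have order above
    [j] and drop out. *)
Lemma lcomp_coefE f N n j : vanishes_below N f -> 0 <= n%:Z + N -> j < n%:Z + N ->
  lcomp_coef f h j = \sum_(i < n) f (i%:Z + N) * (h ^ (i%:Z + N)) j.
Proof.
move=> fN nN jn; rewrite /lcomp_coef (fsbigE [seq i%:Z + N | i <- iota 0 n]).
- rewrite (eq_bigl xpredT); last by move=> i; rewrite in_setT.
  by rewrite big_map -{1}[n]subn0 -[iota _ _]/(index_iota 0 n) big_mkord.
- by rewrite map_inj_uniq ?iota_uniq // => x y; lia.
- by [].
- move=> k _ /negP nk; have [/fN ->|kN] := ltP k N; first by rewrite mul0r.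
  have [kn|kn] := ltP k (n%:Z + N).
    by case: nk; apply/mapP; exists `|k - N|%N; rewrite ?mem_iota; lia.
  have -> : k = `|k|%N%:Z by lia.
  by rewrite -exprnP (lexp_below (n:=`|k|%N) h1) ?mulr0 //; lia.
Qed.

(** Only the finitely many negative exponents contribute below [0]. They give powers of [h^-1] up to
    the [m]-th, of order at least [m B] because [B <= 0]. *)
Lemma lcomp_coef_bounded f : exists B, vanishes_below B (lcomp_coef f h).
Proof.
have [N0 fN0] := lcoef_bounded f; have [B0 hB0] := lcoef_bounded h^-1.
pose m := `|N0|%N; pose B := - `|B0|%N%:Z.
have fm : vanishes_below (- m%:Z) f by apply: vanishes_belowW fN0; lia.
have hB : vanishes_below B (h^-1)%R by apply: vanishes_belowW hB0; lia.
exists (B *+ m) => j jB; rewrite (lcomp_coefE (n := m) fm); [|lia|]; last first.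
  by apply: lt_le_trans jB _; rewrite subrr mulrn_wle0 // /B; lia.
apply: big1 => i _; have im := ltn_ord i.
have -> : i%:Z - m%:Z = - (m - i)%N%:Z by lia.
rewrite -exprnN -exprVn (lexp_below (n := m - i) hB) ?mulr0 //.
apply: lt_le_trans jB _; rewrite -{1}(subnK (ltnW im)) mulrnDr gerDl.
by rewrite mulrn_wle0 // /B; lia.
Qed.

Lemma lcompE f N n j : vanishes_below N f -> 0 <= n%:Z + N -> j < n%:Z + N ->
  lcomp f h j = \sum_(i < n) f (i%:Z + N) * (h ^ (i%:Z + N)) j.
Proof.
move=> fN nN jn; rewrite /lcomp; case: pselect => [b|/(_ (lcomp_coef_bounded f)) //].
exact: lcomp_coefE.
Qed.

Lemma lcompD : {morph (fun f => lcomp f h) : f g / f + g}.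
Proof.
move=> f g; apply/laurentP => j; have [N [fN gN]] := laurent_bounded2 f g.
have fgN := ladd_below fN gN; pose n := (`|j| + `|N|).+1%N.
rewrite lcoefD !(@lcompE _ N n) //; try (rewrite /n; lia).
by rewrite -big_split; apply: eq_bigr => i _; rewrite lcoefD mulrDl.
Qed.

Lemma lcomp_below f n : 0 <= n -> vanishes_below n f -> vanishes_below n (lcomp f h).
Proof. by move=> n0 fn j jn; rewrite (@lcompE _ n 0) ?add0r ?big_ord0. Qed.

Lemma lcomp_lcontinuous : lcontinuous (fun f => lcomp f h).
Proof.
move=> n; exists (Order.max 0 n) => f fn.
apply: (@vanishes_belowW _ _ (Order.max 0 n)); first by rewrite le_max lexx orbT.
by apply: lcomp_below fn; rewrite le_max lexx.
Qed.

Lemma lcomp_lterm c n : lcomp (lterm c n) h = lterm c 0 * h ^ n.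
Proof.
apply/laurentP => j; pose m := (`|j| + `|n|).+1%N.
rewrite (@lcompE _ n m) ?lcoef_ltermM ?subr0; [|exact: lterm_below|rewrite /m; lia..].
rewrite /m big_ord_recl big1 ?addr0 /= ?add0r ?eqxx // => i _.
by rewrite /= ifF ?mul0r //; apply/eqP; rewrite /bump /=; lia.
Qed.

Lemma lcomp_lmonom n : lcomp (lmonom F n) h = h ^ n.
Proof. by rewrite lmonomE lcomp_lterm -lmonomE lmonom0 mul1r. Qed.

Lemma lcomp1 : lcomp 1 h = 1.
Proof. by rewrite -lmonom0 lcomp_lmonom expr0z. Qed.

Lemma lcomp_lconst c : lcomp (lterm c 0) h = lterm c 0.
Proof. by rewrite lcomp_lterm expr0z mulr1. Qed.

(** Density, used once in each factor, reduces the claim to [h ^ m * h ^ n = h ^ (m + n)]. *)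
Lemma lcompM : {morph (fun f => lcomp f h) : f g / f * g}.
Proof.
move=> f g; apply: (additive_lcontinuous_eq (phi := fun f => lcomp (f * g) h)
  (psi := fun f => lcomp f h * lcomp g h)) f => /=.
- by move=> f1 f2; rewrite mulrDl lcompD.
- by move=> f1 f2; rewrite lcompD mulrDl.
- exact: (lcontinuous_comp lcomp_lcontinuous (lcontinuous_mulr g)).
- exact: (lcontinuous_comp (lcontinuous_mulr _) lcomp_lcontinuous).
move=> c m; apply: (additive_lcontinuous_eq (phi := fun g => lcomp (lterm c m * g) h)
  (psi := fun g => lcomp (lterm c m) h * lcomp g h)) g => /=.
- by move=> f1 f2; rewrite mulrDr lcompD.
- by move=> f1 f2; rewrite lcompD mulrDr.
- exact: (lcontinuous_comp lcomp_lcontinuous (lcontinuous_mull _)).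
- exact: (lcontinuous_comp (lcontinuous_mull _) lcomp_lcontinuous).
by move=> e n; rewrite ltermM !lcomp_lterm mulrACA ltermM addr0 expfzDr.
Qed.

Lemma lcomp0 : lcomp 0 h = 0.
Proof. by apply: (addrI (lcomp 0 h)); rewrite -lcompD !addr0. Qed.

Lemma lcompN f : lcomp (- f) h = - lcomp f h.
Proof. by apply: (addrI (lcomp f h)); rewrite -lcompD !subrr lcomp0. Qed.

Lemma lcompB f g : lcomp (f - g) h = lcomp f h - lcomp g h.
Proof. by rewrite lcompD lcompN. Qed.

(** A unital multiplicative map sends no invertible element to [0]; injectivity of the substitution
    follows. *)
Lemma lcomp_neq0 f : f != 0 -> lcomp f h != 0.
Proof.
move=> f0; apply/eqP => fh0; have := lcompM f f^-1.
by rewrite divff // fh0 mul0r lcomp1 => /eqP; rewrite oner_eq0.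
Qed.

Lemma lcomp_inv f : f != 0 -> lcomp f^-1 h = (lcomp f h)^-1.
Proof.
move=> f0; have fh0 := lcomp_neq0 f0.
by apply: (mulfI fh0); rewrite -lcompM !divff ?lcomp1.
Qed.

Lemma lcomp_inj : injective (fun f => lcomp f h).
Proof.
move=> f g /= fg; apply/eqP; rewrite -subr_eq0; apply: contraT => /lcomp_neq0.
by rewrite lcompB fg subrr eqxx.
Qed.

Lemma lcompXz f n : f != 0 -> lcomp (f ^ n) h = lcomp f h ^ n.
Proof.
have lcompX g (k : nat) : lcomp (g ^+ k) h = lcomp g h ^+ k.
  by elim: k => [|k IHk]; rewrite ?lcomp1 // !exprS lcompM IHk.
move=> f0; case: n => n; first exact: lcompX.
by rewrite NegzE -!exprnN lcomp_inv ?lcompX // expf_neq0.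
Qed.

End Substitution.

Lemma lcomp_id f : lcomp f (lmonom F 1) = f.
Proof.
have X0 := lmonom_neq0 1.
have X1 : vanishes_below 1 (lmonom F 1) by rewrite lmonomE; apply: lterm_below.
apply: (additive_lcontinuous_eq (phi := fun f => lcomp f (lmonom F 1)) (psi := id)) f => //.
- exact: lcompD.
- exact: lcomp_lcontinuous.
- by move=> n; exists n.
by move=> c n; rewrite lcomp_lterm // lmonomXz -ltermE.
Qed.

(** On a single term, the claim is that substituting [h] commutes with integer powers of [g]. *)
Lemma lcompA f g h : g != 0 -> vanishes_below 1 g -> h != 0 -> vanishes_below 1 h ->
  lcomp f (lcomp g h) = lcomp (lcomp f g) h.
Proof.
move=> g0 g1 h0 h1.
have gh0 := lcomp_neq0 h0 h1 g0; have gh1 := lcomp_below h0 h1 ler01 g1.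
apply: (additive_lcontinuous_eq (phi := fun f => lcomp f (lcomp g h))
  (psi := fun f => lcomp (lcomp f g) h)) f.
- exact: lcompD.
- by move=> f1 f2; rewrite !lcompD.
- exact: lcomp_lcontinuous.
- exact: (lcontinuous_comp (lcomp_lcontinuous h0 h1) (lcomp_lcontinuous g0 g1)).
by move=> c n; rewrite !lcomp_lterm // lcompM // lcompXz // lcomp_lconst.
Qed.

(** * Formal differentiation *)

Lemma lderivE f k : lderiv f k = (k + 1)%:~R * f (k + 1). Proof. by []. Qed.

Lemma lderivD : {morph @lderiv F : f g / f + g}.
Proof. by move=> f g; apply/laurentP => k; rewrite lcoefD !lderivE lcoefD mulrDr. Qed.

Lemma lderiv_lcontinuous : lcontinuous (@lderiv F).
Proof.
by move=> n; exists (n + 1) => f fn k kn; rewrite lderivE fn ?mulr0 // ltrD2r.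
Qed.

Lemma lderiv_lterm c n : lderiv (lterm c n) = lterm (n%:~R * c) (n - 1).
Proof.
apply/laurentP => k; rewrite lderivE /=.
by rewrite -subr_eq opprK; case: eqP => [->|_]; rewrite ?mulr0 ?subrK //.
Qed.

Lemma lderivM f g : lderiv (f * g) = lderiv f * g + f * lderiv g.
Proof.
apply: (additive_lcontinuous_eq (phi := fun f => lderiv (f * g))
  (psi := fun f => lderiv f * g + f * lderiv g)) f => /=.
- by move=> f1 f2; rewrite mulrDl lderivD.
- by move=> f1 f2; rewrite lderivD !mulrDl addrACA.
- exact: (lcontinuous_comp lderiv_lcontinuous (lcontinuous_mulr g)).
- apply: lcontinuousD (lcontinuous_mulr _).
  exact: (lcontinuous_comp (lcontinuous_mulr g) lderiv_lcontinuous).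
move=> c m; apply: (additive_lcontinuous_eq (phi := fun g => lderiv (lterm c m * g))
  (psi := fun g => lderiv (lterm c m) * g + lterm c m * lderiv g)) g => /=.
- by move=> f1 f2; rewrite mulrDr lderivD.
- by move=> f1 f2; rewrite lderivD !mulrDr addrACA.
- exact: (lcontinuous_comp lderiv_lcontinuous (lcontinuous_mull _)).
- apply: lcontinuousD; first exact: lcontinuous_mull.
  exact: (lcontinuous_comp (lcontinuous_mull _) lderiv_lcontinuous).
move=> e n; rewrite ltermM !lderiv_lterm !ltermM.
rewrite addrA (addrAC m (-1)); apply/laurentP => k; rewrite lcoefD /=.
by case: eqP => _; rewrite ?addr0 // intrD; ring.
Qed.

Lemma lderiv_lconst c : lderiv (lterm c 0) = 0.
Proof. by rewrite lderiv_lterm mul0r lterm0. Qed.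

Lemma lconst_intS (n : int) : lterm (n + 1)%:~R 0 = lterm n%:~R 0 + 1 :> laurent F.
Proof.
by apply/laurentP => k; rewrite lcoefD lcoef1 /= intrD; case: eqP; rewrite ?addr0.
Qed.

Lemma lderivXz h (n : int) : h != 0 ->
  lderiv (h ^ n) = lterm n%:~R 0 * h ^ (n - 1) * lderiv h.
Proof.
move=> h0; pose Q (m : int) := lderiv (h ^ m) = lterm m%:~R 0 * h ^ (m - 1) * lderiv h.
have hS m : h ^ m = h ^ (m - 1) * h.
  by rewrite -{3}[h]expr1z -expfzDr // subrK.
(* As [h] is invertible, the product rule works upwards and downwards, so negative exponents are
   also reached from [Q 0]. *)
have QS m : Q m <-> Q (m + 1).
  rewrite /Q lconst_intS addrK [h ^ (m + 1)]expfzDr // expr1z lderivM.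
  split=> [->|]; first by rewrite [h ^ m]hS; ring.
  move=> E; apply: (mulIf h0); apply: (addIr (h ^ m * lderiv h)); rewrite E.
  by rewrite [h ^ m]hS; ring.
have Q0 : Q 0.
  rewrite /Q expr0z -lmonom0 lmonomE lderiv_lconst.
  by rewrite lterm0 !mul0r.
rewrite -[_ = _]/(Q n); elim/int_ind: n => [//|n|n] Qn.
  by rewrite -addn1 PoszD; apply: (QS _).1.
by apply: (QS _).2; rewrite (_ : _ + 1 = - n%:Z) //; lia.
Qed.

Lemma lderiv_lcomp f h : h != 0 -> vanishes_below 1 h ->
  lderiv (lcomp f h) = lcomp (lderiv f) h * lderiv h.
Proof.
move=> h0 h1; apply: (additive_lcontinuous_eq (phi := fun f => lderiv (lcomp f h))
  (psi := fun f => lcomp (lderiv f) h * lderiv h)) f.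
- by move=> f1 f2; rewrite lcompD // lderivD.
- by move=> f1 f2; rewrite lderivD lcompD // mulrDl.
- exact: (lcontinuous_comp lderiv_lcontinuous (lcomp_lcontinuous h0 h1)).
- apply: (lcontinuous_comp (lcontinuous_mulr _)).
  exact: (lcontinuous_comp (lcomp_lcontinuous h0 h1) lderiv_lcontinuous).
move=> c n; rewrite lderiv_lterm !lcomp_lterm // lderivM lderiv_lconst mul0r add0r.
by rewrite lderivXz // !mulrA ltermM addr0 mulrC [c * _]mulrC mulrC.
Qed.

(* The factor [- t^2] comes from [d/dz = - t^2 d/dt] for [t = z^-1]. *)
Lemma lderivVE f : lderivV f = - (lmonom F 2 * lderiv f).
Proof.
apply/laurentP => k; rewrite lcoefN lcoef_lmonomM lderivE /= mulNr.
by rewrite (_ : k - 2 + 1 = k - 1) //; lia.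
Qed.

End LaurentComposition.

(** * Generating series and convolution recursions *)

Section PowerSeries.
Variable F : fieldType.
Implicit Types (a b : nat -> F) (f : laurent F).

Lemma lseries_below a : vanishes_below 0 (lseries a).
Proof. by case. Qed.

Lemma lseriesM a b : lseries a * lseries b =
  lseries (fun n => \sum_(i < n.+1) a i * b (n - i)%N).
Proof.
have aB := lseries_below a; have bB := lseries_below b.
apply/laurentP => -[n|n]; last by rewrite (lmul_below aB bB).
have := lconvE n aB bB; rewrite !addr0 -[lconv _ _ _]/((lseries a * lseries b) n) => ->.
rewrite coefM /=; apply: eq_bigr => i _.
by rewrite !coef_ltrunc ?leq_subr ?addr0 // -ltnS.
Qed.

Lemma lcoef_lmonom1M f (n : nat) : (lmonom F 1 * f) n.+1%:Z = f n%:Z.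
Proof. by rewrite lcoef_lmonomM; congr (f _); lia. Qed.

Lemma lseries_recl a :
  lseries a = lterm (a 0%N) 0 + lmonom F 1 * lseries (fun n => a n.+1).
Proof.
apply/laurentP => -[[|n]|n]; rewrite lcoefD ?lcoef_lmonom1M ?lcoef_lmonomM /=.
- by rewrite addr0.
- by rewrite add0r.
- by rewrite addr0.
Qed.

Definition lshift a : laurent F := lseries (fun k => if k is n.+1 then a n else 0).

Lemma eq_lshift a b : a =1 b -> lshift a = lshift b.
Proof. by move=> ab; apply/laurentP => -[[|n]|n] //=. Qed.

Lemma lshift_below a : vanishes_below 1 (lshift a).
Proof. by case=> [[|n]|n] //; rewrite ltz_nat. Qed.

Lemma lshift_recl a :
  lshift a = lmonom F 1 * (lterm (a 0%N) 0 + lshift (fun n => a n.+1)).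
Proof.
apply/laurentP => -[[|n]|n]; rewrite ?lcoef_lmonom1M ?lcoef_lmonomM lcoefD //= ?addr0 //.
by case: n => [|n] /=; rewrite ?addr0 ?add0r.
Qed.

Lemma lshiftD a b : lshift a + lshift b = lshift (fun n => a n + b n).
Proof. by apply/laurentP => -[[|n]|n]; rewrite lcoefD //= addr0. Qed.

Lemma lshiftZ c a : lterm c 0 * lshift a = lshift (fun n => c * a n).
Proof. by apply/laurentP => -[[|n]|n]; rewrite lcoef_ltermM subr0 //= mulr0. Qed.

(** The exponents [l + 1] and [m + 1] add up to [n + 1] for [n = l + m + 1], hence the index
    [n - l.+1]: this is the convolution of [nc_shifted_rec]. *)
Lemma lshiftM a b : lshift a * lshift b =
  lshift (fun n => \sum_(l < n) a l * b (n - l.+1)%N).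
Proof.
rewrite lseriesM; apply/laurentP => -[[|n]|n] //=.
  by rewrite big_ord_recl big_ord0 mul0r addr0.
rewrite big_ord_recl mul0r add0r big_ord_recr /= subSS subnn mulr0 addr0.
by apply: eq_bigr => l _; rewrite /bump /= subSS -(subnSK (ltn_ord l)).
Qed.

(* Iterating the recursion [n] times leaves a remainder divisible by [G^n]. *)
Lemma affine_recursion_unique (G : laurent F) (c V W : nat -> laurent F) :
  vanishes_below 1 G ->
  (forall s, vanishes_below 0 (V s)) -> (forall s, vanishes_below 0 (W s)) ->
  (forall s, V s = c s + G * V s.+1) -> (forall s, W s = c s + G * W s.+1) ->
  forall s, V s = W s.
Proof.
move=> G1 V0 W0 VE WE.
suff VW (n : nat) : forall s, vanishes_below n%:Z (V s - W s).
  move=> s; apply/eqP; rewrite -subr_eq0; apply/eqP/laurentP => k.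
  by apply: (VW `|k|.+1%N); lia.
elim: n => [|n IHn] s; first exact: lsub_below.
rewrite VE WE opprD addrACA subrr add0r -mulrBr.
by rewrite -add1n PoszD; apply: lmul_below.
Qed.

End PowerSeries.

(** * The transforms *)

Section Transforms.
Variables (F : fieldType) (d : inf_distribution F) (kappa kappa' : nat -> F).
Hypotheses (hkappa : free_cumulants d kappa)
           (hkappa' : inf_free_cumulants d kappa kappa').

Let t := lmonom F 1.
Let G := cauchy_transform d.
Let g := inf_cauchy_transform d.
Let r := inf_r_transform kappa'.
Let K := K_transform kappa.

Let U s := lshift (fun n => nc_shifted kappa n s).
Let u s := lshift (fun n => inf_nc_shifted kappa kappa' n s).

Lemma momentE n : moment d n = nc_moment kappa n.
Proof.
by case: n => [|n]; [rewrite nc_moment0 /moment expr0 law1 | apply: hkappa].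
Qed.

Lemma inf_momentE n : inf_moment d n = inf_nc_moment kappa kappa' n.
Proof.
case: n => [|n]; first by rewrite inf_nc_moment0 /inf_moment expr0 inf_law1.
by rewrite inf_nc_momentE hkappa'.
Qed.

Lemma cauchy_lshift : G = lshift (nc_moment kappa).
Proof. by apply: eq_lshift; apply: momentE. Qed.

Lemma inf_cauchy_lshift : g = lshift (inf_nc_moment kappa kappa').
Proof.
by apply/laurentP => -[[|[|n]]|n] //=; rewrite ?inf_nc_moment0 ?inf_momentE.
Qed.

Lemma cauchy_below : vanishes_below 1 G.
Proof. exact: lshift_below. Qed.

Lemma cauchy_neq0 : G != 0.
Proof.
apply/eqP => /laurentP/(_ 1); rewrite /= /moment expr0 law1 => /eqP.
by rewrite oner_eq0.
Qed.

Let G0 := cauchy_neq0.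
Let G1 := cauchy_below.

Lemma lcomp_t_cauchy : lcomp t G = G.
Proof. by rewrite lcomp_lmonom // expr1z. Qed.

Lemma cauchy_recursion s : U s = lterm (kappa s.+1) 0 * G + G * U s.+1.
Proof.
rewrite cauchy_lshift lshiftZ lshiftM lshiftD.
by apply: eq_lshift => n; apply: nc_shifted_rec.
Qed.

Lemma inf_cauchy_recursion s :
  u s = lterm (kappa' s.+1) 0 * G + lterm (kappa s.+1) 0 * g + g * U s.+1 + G * u s.+1.
Proof.
rewrite inf_cauchy_lshift cauchy_lshift !lshiftZ !lshiftM !lshiftD.
by apply: eq_lshift => n; rewrite inf_nc_shifted_rec big_split addrA.
Qed.

Lemma cauchyE : G = t * (1 + U 0).
Proof.
rewrite cauchy_lshift lshift_recl nc_moment0 -lmonomE lmonom0.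
by congr (_ * (_ + _)); apply: eq_lshift => n; rewrite nc_momentS.
Qed.

Lemma inf_cauchyE : g = t * u 0.
Proof.
rewrite inf_cauchy_lshift lshift_recl inf_nc_moment0 lterm0 add0r.
by congr (_ * _); apply: eq_lshift => n; rewrite inf_nc_momentS.
Qed.

(** * Solution of the recursions *)

Let tail (a : nat -> F) s := lseries (fun n => a (s + n).+1).
(** This is the derivative of [t * tail kappa s]; it arises as the variation of
    [G * lcomp (tail kappa s) G] when [G] moves in the direction [g]. *)
Let weighted_tail s := lseries (fun n => n.+1%:R * kappa (s + n).+1).

Lemma tail_rec a s : tail a s = lterm (a s.+1) 0 + t * tail a s.+1.
Proof.
rewrite /tail lseries_recl addn0; congr (_ + _ * _).
by apply/laurentP => -[n|n] //=; rewrite addSnnS.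
Qed.

Lemma lcomp_tail_rec a s :
  lcomp (tail a s) G = lterm (a s.+1) 0 + G * lcomp (tail a s.+1) G.
Proof. by rewrite tail_rec lcompD // lcompM // lcomp_t_cauchy lcomp_lconst. Qed.

Lemma weighted_tail_rec s : weighted_tail s = tail kappa s + t * weighted_tail s.+1.
Proof.
apply/laurentP => -[[|n]|n]; rewrite lcoefD ?lcoef_lmonom1M ?lcoef_lmonomM /= ?addr0 ?mul1r //.
by rewrite addSnnS -[in LHS]natr1 mulrDl mul1r addrC.
Qed.

Lemma lcomp_weighted_tail_rec s :
  lcomp (weighted_tail s) G = lcomp (tail kappa s) G + G * lcomp (weighted_tail s.+1) G.
Proof. by rewrite {1}weighted_tail_rec lcompD // lcompM // lcomp_t_cauchy. Qed.

Lemma lcomp_series_below a : vanishes_below 0 (lcomp (lseries a) G).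
Proof. by apply: lcomp_below => //; apply: lseries_below. Qed.

Lemma below1_0 (f : laurent F) : vanishes_below 1 f -> vanishes_below 0 f.
Proof. exact: vanishes_belowW. Qed.

Lemma shifted_seriesE s : U s = G * lcomp (tail kappa s) G.
Proof.
apply: (affine_recursion_unique (c := fun s => lterm (kappa s.+1) 0 * G)
  (V := U) (W := fun s => G * lcomp (tail kappa s) G) G1).
- by move=> k; apply/below1_0/lshift_below.
- move=> k; apply: below1_0; rewrite -[1]addr0.
  by apply: lmul_below => //; apply: lcomp_series_below.
- exact: cauchy_recursion.
- by move=> k; rewrite lcomp_tail_rec mulrDr [G * lterm _ _]mulrC.
Qed.

(** Both sides solve one affine recursion. Its inhomogeneous term contains [U s.+1], so the closed
    form [shifted_seriesE] has to be known already. *)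
Lemma inf_shifted_seriesE s : u s = G * lcomp (tail kappa' s) G + g * lcomp (weighted_tail s) G.
Proof.
apply: (affine_recursion_unique (c := fun s => lterm (kappa' s.+1) 0 * G +
  lterm (kappa s.+1) 0 * g + g * U s.+1) (V := u)
  (W := fun s => G * lcomp (tail kappa' s) G + g * lcomp (weighted_tail s) G) G1).
- by move=> k; apply/below1_0/lshift_below.
- move=> k; apply: below1_0; rewrite -[1]addr0 inf_cauchy_lshift.
  apply: ladd_below; apply: lmul_below; try exact: lcomp_series_below.
    exact: G1.
  exact: lshift_below.
- exact: inf_cauchy_recursion.
- by move=> k; rewrite lcomp_weighted_tail_rec !(lcomp_tail_rec _ k) shifted_seriesE; ring.
Qed.

(** The relation [G = t (1 + G R(G))], divided by [t G], reads [1/t = 1/G + R(G)]. *)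
Lemma lcomp_K_cauchy : lcomp K G = lmonom F (-1).
Proof.
have t0 : t != 0 := lmonom_neq0 F 1.
rewrite lcompD // lcomp_lmonom // exprN1 -[R_transform _]/(tail kappa 0) -lmonomV -/t.
apply: (mulfI t0); apply: (mulfI G0); rewrite divff // mulr1 [RHS]cauchyE shifted_seriesE.
by field; apply: G0.
Qed.

(** Both sides are [(t R)'], since [t K = 1 + t R]. At exponent [-1] the pole of [K] cancels against
    that of [t K']. *)
Lemma weighted_tail_deriv : weighted_tail 0 = K + t * lderiv K.
Proof.
apply/laurentP => k; rewrite lcoefD lcoef_lmonomM lderivE subrK lcoefD.
case: k => [n|[|n]] /=.
- by rewrite add0r add0n -natr1 mulrDl mul1r addrC.
- by rewrite addr0 mulr1 subrr.
- by rewrite addr0 mulr0 addr0.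
Qed.

(** As [K(G) = 1/t], the contribution [t g K(G)] equals [g] and cancels the left side; what remains
    is [t G (r(G) + g K'(G)) = 0]. *)
Lemma inf_r_cauchy : lcomp r G = - (g * lcomp (lderiv K) G).
Proof.
have t0 : t != 0 := lmonom_neq0 F 1.
have gE := inf_cauchyE; rewrite inf_shifted_seriesE weighted_tail_deriv lcompD // lcompM // lcomp_t_cauchy in gE.
rewrite lcomp_K_cauchy -lmonomV -/t in gE.
rewrite -[tail kappa' 0]/r in gE.
apply/eqP; rewrite -addr_eq0; apply/eqP.
apply: (mulfI (mulf_neq0 t0 G0)); rewrite mulr0.
apply: (addIr g); by rewrite add0r [RHS]gE; field; apply: t0.
Qed.

Lemma lderiv_K_cauchy : lcomp (lderiv K) G * lderiv G = - lmonom F (-2).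
Proof.
rewrite -lderiv_lcomp // lcomp_K_cauchy lmonomE lderiv_lterm mulr1.
by rewrite lmonomE; apply/laurentP => k; rewrite lcoefN /=; case: eqP; rewrite ?oppr0.
Qed.

(** The factor [- t^2] from [d/dz] cancels the [- t^-2] obtained by differentiating
    [K(G) = t^-1]. *)
Lemma inf_cauchy_inf_r : g = - (lcomp r G * lderivV G).
Proof.
rewrite lderivVE inf_r_cauchy.
have -> : - (- (g * lcomp (lderiv K) G) * - (lmonom F 2 * lderiv G)) =
  - (g * lmonom F 2 * (lcomp (lderiv K) G * lderiv G)) by ring.
by rewrite lderiv_K_cauchy mulrN opprK -mulrA lmonomM lmonom0 mulr1.
Qed.

(** * The compositional inverse and the formula for [r] *)

Lemma K_leading : K (-1) = 1.
Proof. by rewrite /K /K_transform lcoefD /= addr0. Qed.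

Lemma K_neq0 : K != 0.
Proof. by apply/eqP => K0; have /eqP := K_leading; rewrite K0 eq_sym oner_eq0. Qed.

(** As [K] has order exactly [-1], its inverse has positive order, which makes [lcompV] at [K]
    meaningful. *)
Lemma K_inv_below : vanishes_below 1 (K^-1)%R.
Proof.
rewrite -[1]opprK; apply: linv_below; last by rewrite K_leading oner_neq0.
move=> k k1; rewrite lcoefD /= lt_eqF // add0r.
by case: k k1.
Qed.

Let L0 : K^-1 != 0. Proof. by rewrite invr_eq0 K_neq0. Qed.
Let L1 := K_inv_below.

Lemma lcomp_Kinv_cauchy : lcomp K^-1 G = t.
Proof. by rewrite lcomp_inv ?K_neq0 // lcomp_K_cauchy lmonomV. Qed.

(** Since [K^-1] at [G] is [t], substituting [G] into [lcompV G K] gives back [G], which is also [t]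
    at [G]; injectivity removes the substitution. *)
Lemma K_comp_inverse : comp_inverse G K.
Proof.
split; last exact: lcomp_K_cauchy.
apply: (lcomp_inj G0 G1); rewrite /lcompV -(lcompA _ L0 L1 G0 G1) lcomp_Kinv_cauchy.
by rewrite lcomp_id lcomp_t_cauchy.
Qed.

(** After substitution of [G] this is [inf_r_cauchy]. *)
Lemma inf_r_inf_cauchy : r = - (lcompV g K * lderiv K).
Proof.
apply: (lcomp_inj G0 G1); rewrite lcompN // lcompM // /lcompV -(lcompA _ L0 L1 G0 G1).
by rewrite lcomp_Kinv_cauchy lcomp_id inf_r_cauchy.
Qed.

End Transforms.
Unset Implicit Arguments.

Theorem theorem2 (R : realType) (d : inf_distribution R[i])
    (kappa kappa' : nat -> R[i])
    (hkappa : free_cumulants d kappa)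
    (hkappa' : inf_free_cumulants d kappa kappa') :
  let G := cauchy_transform d in
  let g := inf_cauchy_transform d in
  let r := inf_r_transform kappa' in
  let K := K_transform kappa in
  [/\ comp_inverse G K,
      g = - (lcomp r G * lderivV G)
    & r = - (lcompV g K * lderiv K)].
Proof.
split.
- exact: (K_comp_inverse hkappa).
- exact: (inf_cauchy_inf_r hkappa hkappa').
- exact: (inf_r_inf_cauchy hkappa hkappa').
Qed.
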